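(* Let $k$ be a positive integer. There exist a constant $C$ and a function $g(n)=o(n)$ such that for every polynomial $f\in\overline{\mathbb{Q}}[x]$ of degree $n$ all of whose roots are nonzero and have degree at most $k$ over $\mathbb{Q}$, we have $n-g(n)\le C\log H(f)$.
   Context: For a number field $L$ of degree $d$ containing the coefficients of $f=a_nx^n+\dots+a_0$: for each nonzero prime ideal $\mathfrak p$ of $\mathcal O_L$, $|x|_{\mathfrak p}=N(\mathfrak p)^{-\mathrm{ord}_{\mathfrak p}(x)}$ with $N(\mathfrak p)=[\mathcal O_L:\mathfrak p]$; for each embedding $\sigma:L\to\mathbb{C}$, $|x|_\sigma=|\sigma(x)|$. The Gauss norm is $|f|_v=\max_{0\le i\le n}|a_i|_v$, and the height $H(f)$ is defined by $H(f)^d=\prod_{\mathfrak p}|f|_{\mathfrak p}\prod_\sigma|f|_\sigma$, products over all nonzero primes of $\mathcal O_L$ and all embeddings $L\to\mathbb{C}$; this is independent of the choice of $L$. *)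

(* Defs.v *)
From HB Require Import structures.
From mathcomp Require Import all_boot all_order all_algebra all_field.
From mathcomp Require Import mathcomp_extra boolp classical_sets cardinality.
From mathcomp Require Import fsbigop reals topology normedtype landau exp.
From mathcomp Require Import finmap ring_quotient complex.

Set Implicit Arguments.
Unset Strict Implicit.
Unset Printing Implicit Defensive.

Import Order.TTheory GRing.Theory Num.Theory.
Import numFieldNormedType.Exports.

Local Open Scope classical_set_scope.
Local Open Scope ring_scope.

Section RingOfIntegers.
Variable L : fieldExtType rat.

Definition is_integer : {pred L} :=
  fun x => `[< integralOver (intr : int -> L) x >].

Lemma is_integer_subring : subring_closed is_integer.
Proof.
split=> [|x y /asboolP xI /asboolP yI|x y /asboolP xI /asboolP yI];
  apply/asboolP.
- exact: integral1.
- exact: integral_sub.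
- exact: integral_mul.
Qed.

HB.instance Definition _ :=
  GRing.isSubringClosed.Build L is_integer is_integer_subring.

Record ringOfIntegers := RingOfIntegers {
  int_val :> L;
  int_valP : int_val \in is_integer
}.

HB.instance Definition _ := [isSub for int_val].
HB.instance Definition _ := [Choice of ringOfIntegers by <:].
HB.instance Definition _ := [SubChoice_isSubComNzRing of ringOfIntegers by <:].

End RingOfIntegers.

Section PrimeIdeals.
Variable A : comNzRingType.
Implicit Types (I J P : set A) (a : A).

(* [idealr_closed] requires the ideal to be proper. *)
Definition nonzero_prime_ideals : set (set A) :=
  [set P : set A | [/\ idealr_closed (mem P), prime_idealr_closed (mem P)
             & exists2 a, P a & a != 0]].

Definition ideal_mul I J : set A :=
  [set a | exists s : seq (A * A),
     (forall t, t \in s -> I t.1 /\ J t.2) /\ a = \sum_(t <- s) t.1 * t.2].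

Definition ideal_exp I m : set A := iter m (ideal_mul I) setT.

(* Number of cosets of P; meaningful when P has finite index. *)
Definition ideal_norm P : nat :=
  #|` fset_set [set [set b | P (b - a)] | a in @setT A]|%fset.

(* For a != 0 in a Dedekind domain, the unique m such that P^m divides (a)
   and P^(m+1) does not. *)
Definition ord_integer P a : nat :=
  xget 0%N [set m | ideal_exp P m a /\ ~ ideal_exp P m.+1 a].

End PrimeIdeals.

Section Height.
Variables (R : realType) (L : fieldExtType rat).
Implicit Types (P : set (ringOfIntegers L)) (x : L) (p : {poly L}).

(* Every x in L is a fraction a / b of integers, and for x != 0 the difference
   below does not depend on a and b. *)
Definition ord P x : int :=
  xget 0 [set m | exists a b : ringOfIntegers L,
    [/\ b != 0, x = int_val a / int_val b
      & m = (ord_integer P a)%:Z - (ord_integer P b)%:Z]].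

Definition abs_prime P x : R :=
  if x == 0 then 0 else (ideal_norm P)%:R ^ (- ord P x).

Definition embeddings : set (L -> R[i]) :=
  [set s : L -> R[i] |
     exists t : {rmorphism L -> R[i]}, s = t :> (L -> R[i])].

Definition abs_embedding (s : L -> R[i]) x : R := Normc.normc (s x).

Definition gauss_norm (abs : L -> R) p : R :=
  \big[Num.max/0]_(i < size p) abs p`_i.

(* Both products are over finitely supported families when p != 0; this is
   the convention of the big operator over a set. *)
Definition height p : R :=
  ((\big[*%R/1]_(P \in @nonzero_prime_ideals (ringOfIntegers L))
      gauss_norm (abs_prime P) p) *
   (\big[*%R/1]_(s \in embeddings) gauss_norm (abs_embedding s) p))
  `^ ((\dim {:L})%:R^-1).

End Height.

Arguments height R {L} p.

(* Main.v *)
(** Put T = (2^k)! and let q be an integer polynomial of degree N whose roots are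
    nonzero of degree at most k. It has at least N/k irreducible factors mu over
    Z. If the leading or the constant coefficient of mu is even, mu contributes a
    factor 2 to that coefficient of q. Otherwise X is invertible modulo mu over
    F_2, so mu divides X^T - 1 = X^T + 1 mod 2, and mu contributes a factor 2 to
    Res(q, X^T + 1). This resultant is nonzero, since roots of X^T + 1 have order
    divisible by a large power of 2, hence degree greater than k. As all three
    integers are bounded in terms of the coefficients of q, N is at most a
    constant times the logarithm of the size of q.

    For p over a number field L of degree d, this is applied to the norm of p
    divided by the norm of the content ideal of p, an integer polynomial of degree
    n d whose leading coefficient, constant coefficient and resultant with X^T + 1
    are bounded by powers of (c n^T H(p))^d, with c depending only on k. The
    finite part of the height enters through the factorization of ideals:
    prod_P |p|_P = [O : b O] / [O : I], where b p is integral with content ideal I. *)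

(* Modulo 2 the polynomials X^T + 1 and X^T - 1 coincide, but q may vanish at roots of unity of
   small degree, such as 1, and its resultant with X^T - 1 would then be 0. The choice T = (2^k)!
   meets two demands. It is a multiple of every s <= 2^k, because the powers of X modulo a
   polynomial of degree at most k over F_2 repeat within 2^k steps. It is also divisible by 2^k, so
   a root of X^T + 1 has order divisible by 2^(k+1) and degree at least 2^k. The resultant is taken
   as the determinant of q at a companion matrix. This is multiplicative in q, and the matrix has
   size T whatever the degree of q, so a bound B on the coefficients gives a bound polynomial in B
   and the degree. It is applied to each of the d conjugates of p separately: each costs a factor T!
   (n+1)^T, so after taking logarithms and dividing by d the error is O(log n), uniformly in L.
   Clearing the denominators of the norm of p would cost more than the height controls; dividing by
   the norm of the content ideal as well leaves a factor accounted for by the finite places. *)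
Require Import Defs.
From HB Require Import structures.
From mathcomp Require Import all_boot all_order all_algebra all_field.
From mathcomp Require Import mathcomp_extra boolp classical_sets cardinality.
From mathcomp Require Import fsbigop reals topology normedtype landau exp.
From mathcomp Require Import finmap ring_quotient complex perm zify ring lra.
Set Implicit Arguments.
Unset Strict Implicit.
Unset Printing Implicit Defensive.
Import Order.TTheory GRing.Theory Num.Theory.
Import numFieldNormedType.Exports.
Local Open Scope classical_set_scope.
Local Open Scope ring_scope.

(** * Resultants with X^T + 1 *)

(* The companion matrix C of X^(m+1) + 1; up to sign, [negadet m q] = det q(C) is
   the resultant of q and X^(m+1) + 1. *)
Definition negacyclic (R : pzRingType) (m : nat) : 'M[R]_m.+1 :=
  \matrix_(i, j) if i == m :> nat then - (j == 0%N :> nat)%:R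
                 else (i.+1 == j :> nat)%:R.

Lemma map_negacyclic (R S : pzRingType) (f : {rmorphism R -> S}) m :
  map_mx f (negacyclic R m) = negacyclic S m.
Proof.
by apply/matrixP=> i j; rewrite !mxE; case: ifP => _; rewrite ?rmorphN rmorph_nat.
Qed.

Section Negacyclic.
Variables (R : comNzRingType) (m : nat).
Local Notation C := (negacyclic R m).

Lemma delta_mul_negacyclic (i : 'I_m.+1) :
  delta_mx 0 i *m C =
  if i == m :> nat then - delta_mx 0 0 else delta_mx 0 (inord i.+1) :> 'rV__.
Proof.
apply/rowP=> j; rewrite -rowE !mxE.
case: ifP => Him; rewrite !mxE //= -val_eqE /= inordK ?[j == _]eq_sym //.
  by rewrite eq_sym.
by have := ltn_ord i; rewrite ltnS leq_eqVlt Him.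
Qed.

(** The first basis row is a cyclic vector for [C], so identities between polynomials in [C] can be
    checked on that row alone. *)
Lemma delta_mul_negacyclicX (i : nat) : (i <= m)%N ->
  delta_mx 0 0 *m C ^+ i = delta_mx 0 (inord i) :> 'rV__.
Proof.
elim: i => [|i IHi] lim.
  by rewrite expr0 mulmx1; congr delta_mx; apply: val_inj; rewrite /= inordK.
rewrite exprSr mulmxA IHi ?(ltnW lim) // delta_mul_negacyclic inordK ?ltnS ?(ltnW lim) //.
by rewrite ltn_eqF.
Qed.

Lemma negacyclic_pow : C ^+ m.+1 = - 1.
Proof.
apply/row_matrixP=> i; rewrite !rowE mulmxN mulmx1.
have -> : delta_mx 0 i = delta_mx 0 0 *m C ^+ i :> 'rV__.
  by rewrite delta_mul_negacyclicX ?inord_val // -ltnS.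
have -> : delta_mx 0 0 *m C ^+ i *m C ^+ m.+1 =
    delta_mx 0 0 *m C ^+ m *m C *m C ^+ i :> 'rV__.
  rewrite -!mulmxA; congr (_ *m _).
  by rewrite -![_ *m _]/(_ * _) -exprD addnC exprD exprSr mulrA.
by rewrite delta_mul_negacyclicX // delta_mul_negacyclic inordK // eqxx mulNmx.
Qed.

Lemma horner_negacyclic : horner_mx C ('X^(m.+1) + 1) = 0.
Proof. by rewrite rmorphD rmorph1 rmorphXn /= horner_mx_X negacyclic_pow addNr. Qed.

(** Since deg h <= m, the first row of h(C) is the coefficient vector of h. *)
Lemma horner_negacyclic_inj (h : {poly R}) :
  (size h <= m.+1)%N -> horner_mx C h = 0 -> h = 0.
Proof.
move=> sh h0; apply/polyP=> i; rewrite coef0.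
have [lthi|ltih] := leqP (size h) i; first exact: nth_default.
have lei : (i < m.+1)%N by apply: leq_trans ltih sh.
have /rowP /(_ (Ordinal lei)) : delta_mx 0 0 *m horner_mx C h = 0 :> 'rV__ by rewrite h0 mulmx0.
rewrite -[h in horner_mx _ h]coefK poly_def rmorph_sum mulmx_sumr summxE mxE.
rewrite (bigD1 (Ordinal ltih)) //= big1 => [|j Hj].
  rewrite addr0 linearZ rmorphXn /= horner_mx_X -scalemxAr mxE.
  rewrite delta_mul_negacyclicX // mxE eqxx -val_eqE /= inordK // eqxx.
  by rewrite mulr1.
rewrite linearZ rmorphXn /= horner_mx_X -scalemxAr mxE.
have lejm : (j <= m)%N by rewrite -ltnS; apply: leq_trans (ltn_ord j) sh.
rewrite delta_mul_negacyclicX // mxE eqxx -val_eqE /= inordK //.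
by move: Hj; rewrite -val_eqE /= eq_sym => /negbTE->; rewrite mulr0.
Qed.

Definition negadet (q : {poly R}) : R := \det (horner_mx C q).

Lemma negadetM q r : negadet (q * r) = negadet q * negadet r.
Proof. by rewrite /negadet rmorphM det_mulmx. Qed.

Lemma negadet1 : negadet 1 = 1.
Proof. by rewrite /negadet rmorph1 det1. Qed.

Lemma negadetC c : negadet c%:P = c ^+ m.+1.
Proof. by rewrite /negadet horner_mx_C det_scalar. Qed.

Lemma negadet_prod (I : Type) (r : seq I) (F : I -> {poly R}) :
  negadet (\prod_(i <- r) F i) = \prod_(i <- r) negadet (F i).
Proof. exact: (big_morph _ negadetM negadet1). Qed.

End Negacyclic.

Lemma negadet_map (R S : comNzRingType) (f : {rmorphism R -> S}) m (q : {poly R}) :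
  negadet m (map_poly f q) = f (negadet m q).
Proof.
by rewrite /negadet -(map_negacyclic f) -map_horner_mx det_map_mx.
Qed.

(** Multiplication by [C] permutes the basis rows up to sign. *)
Lemma negacyclicX_bound (R : numDomainType) m i (a b : 'I_m.+1) :
  `|(negacyclic R m ^+ i) a b| <= 1.
Proof.
elim: i a => [|i IHi] a.
  by rewrite expr0 mxE; case: eqP => _; rewrite ?normr1 // normr0 ler01.
have -> : (negacyclic R m ^+ i.+1) a b =
          (delta_mx 0 a *m negacyclic R m ^+ i.+1 : 'rV__) 0 b.
  by rewrite -rowE mxE.
rewrite exprS mulmxA delta_mul_negacyclic.
by case: ifP => _; rewrite ?mulNmx -rowE mxE ?normrN ?mxE IHi.
Qed.

(** Leibniz expansion: (m+1)! products of m+1 entries, each entry being a combination of at most n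
    coefficients with weights of absolute value at most 1. *)
Lemma negadet_bound (R : numDomainType) m n (q : {poly R}) (B : R) :
  (size q <= n)%N -> (forall i, `|q`_i| <= B) ->
  `|negadet m q| <= m.+1`!%:R * (n%:R * B) ^+ m.+1.
Proof.
move=> sq qB; have B0 : 0 <= B by apply: le_trans (qB 0%N).
have ent a b : `|horner_mx (negacyclic R m) q a b| <= n%:R * B.
  rewrite -[q in horner_mx _ q]coefK poly_def rmorph_sum summxE.
  apply: le_trans (ler_norm_sum _ _ _) _.
  apply: (@le_trans _ _ (\sum_(i < size q) B)).
    apply: ler_sum => i _; rewrite /= linearZ rmorphXn /= horner_mx_X mxE normrM.
    by rewrite -[leRHS]mulr1 ler_pM // negacyclicX_bound.
  by rewrite sumr_const card_ord -[leLHS]mulr_natl ler_wpM2r // ler_nat.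
rewrite /negadet /determinant; apply: le_trans (ler_norm_sum _ _ _) _.
apply: (@le_trans _ _ (\sum_(s : 'S_(m.+1)) (n%:R * B) ^+ m.+1)).
  apply: ler_sum => s _; rewrite normrM normr_sign mul1r normr_prod.
  rewrite -[X in _ <= _ ^+ X]card_ord -prodr_const.
  by apply: ler_prod => i _; rewrite normr_ge0 ent.
by rewrite sumr_const card_Sn -[leLHS]mulr_natl.
Qed.

(** * Integer polynomials with roots of small degree *)

(** There are 2^j residues modulo h, where j = deg h, so two of the powers X^0, ..., X^(2^j) agree.
    As h(0) != 0, X is coprime to h and the smaller power cancels. *)
Lemma poly_F2_dvd_XnsubC k (h : {poly 'F_2}) :
  (1 < size h <= k.+1)%N -> h`_0 != 0 ->
  exists s, (0 < s <= 2 ^ k)%N /\ h %| 'X^s - 1.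
Proof.
case Dj: (size h) => [|j] //= jk h00.
have h0 : h != 0 by rewrite -size_poly_eq0 Dj.
pose f (i : 'I_(2 ^ j).+1) : 'rV['F_2]_j := poly_rV ('X^i %% h).
have /injectivePn [a [b Dab fab]] : ~~ injectiveb f.
  apply/negP => /injectiveP /leq_card.
  by rewrite card_mx card_ord card_Fp // mul1n ltnn.
wlog ltab : a b Dab fab / (a < b)%N.
  move=> W; have [ltab|ltba|/val_inj eab] := ltngtP a b.
  - exact: W Dab fab ltab.
  - by apply: W (esym fab) ltba; rewrite eq_sym.
  - by rewrite eab eqxx in Dab.
have szm i : (size ('X^i %% h)%R <= j)%N by rewrite -ltnS -Dj ltn_modp.
have modE : 'X^b %% h = 'X^a %% h.
  by rewrite -[LHS](poly_rV_K (szm _)) -[RHS](poly_rV_K (szm _)) -/(f _) -/(f _) fab.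
exists (b - a)%N; split.
  rewrite subn_gt0 ltab /= (leq_trans (leq_subr _ _)) // -ltnS.
  by rewrite (leq_trans (ltn_ord b)) // ltnS leq_pexp2l //; case/andP: jk.
have : h %| 'X^a * ('X^(b - a) - 1).
  by rewrite mulrBr mulr1 -exprD subnKC ?(ltnW ltab) // /dvdp modpD modpN modE subrr.
rewrite Gauss_dvdpr // coprimep_expr // coprimep_sym.
by rewrite -['X]subr0 -polyC0 coprimep_sym coprimep_XsubC rootE horner_coef0.
Qed.

Lemma XnsubC_dvd (R : idomainType) s t : (s %| t)%N ->
  exists h : {poly R}, 'X^t - 1 = ('X^s - 1) * h.
Proof.
case/dvdnP=> c ->; exists (\sum_(i < c) ('X^s) ^+ i).
by rewrite mulnC exprM subrX1.
Qed.

(* q mod 2 divides X^s - 1 for some s <= 2^k, hence X^T - 1 = X^T + 1 with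
   T = m + 1. *)
Lemma even_negadet k m (q : {poly int}) : m.+1 = (2 ^ k)`! ->
  (1 < size q <= k.+1)%N -> ~~ (2 %| lead_coef q)%Z -> ~~ (2 %| q`_0)%Z ->
  (2 %| negadet m q)%Z.
Proof.
move=> Dm sq lq cq; pose f : {rmorphism int -> 'F_2} := intr.
have f0 (z : int) : (f z == 0) = (2 %| z)%Z.
  by rewrite /f /= -(dvdz_pcharf (pchar_Fp (isT : prime 2))).
rewrite -f0 -negadet_map; set h := map_poly f q.
have sh : size h = size q by rewrite size_poly_eq // f0.
have [s [/andP[s0 s2] hs]] : exists s, (0 < s <= 2 ^ k)%N /\ h %| 'X^s - 1.
  by apply: poly_F2_dvd_XnsubC; rewrite ?sh // coef_map f0.
have [g Dg] : exists g, 'X^(m.+1) + 1 = h * g.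
  have [g1 Dg1] : exists g : {poly 'F_2}, 'X^(m.+1) - 1 = ('X^s - 1) * g.
    by apply: XnsubC_dvd; rewrite Dm dvdn_fact // s0.
  case/dvdpP: hs => g2 Dg2; exists (g2 * g1).
  have -> : 'X^(m.+1) + 1 = 'X^(m.+1) - 1 :> {poly 'F_2}.
    by congr (_ + _); rewrite -polyC1 -polyCN; congr _%:P; apply/eqP.
  by rewrite Dg1 Dg2 mulrCA mulrA.
(* If the determinant is nonzero in F_2, then h(C) is invertible and h(C) g(C) = 0 gives g(C) = 0.
   As h is not constant, deg g <= m, so g = 0, which is absurd. *)
apply: contraT => nz; have uh : horner_mx (negacyclic _ m) h \in unitmx.
  by rewrite unitmxE unitfE.
have h0 : h != 0 by rewrite -size_poly_eq0 sh; case: (size q) sq.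
have g0 : g != 0.
  apply: contra_eq_neq Dg => ->; rewrite mulr0 -size_poly_eq0 size_XnaddC //.
have sg : (size g <= m.+1)%N.
  move/(congr1 (fun p : {poly _} => size p)): Dg.
  rewrite size_XnaddC // size_mul // sh.
  by case/andP: sq; case: (size q) => [|[|i]] //= _ _; rewrite !addSn /= => -[->]; rewrite leq_addl.
have: horner_mx (negacyclic 'F_2 m) (h * g) = 0 by rewrite -Dg horner_negacyclic.
rewrite rmorphM => /(congr1 (mulmx (invmx (horner_mx (negacyclic _ m) h)))).
rewrite mulmx0 mulKmx // => /(horner_negacyclic_inj sg) E.
by rewrite E eqxx in g0.
Qed.

Lemma leq_totient_pow2 e N : (2 ^ e.+1 %| N)%N -> (0 < N)%N -> (2 ^ e <= totient N)%N.
Proof.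
move=> dvN N0.
have Ne : (e.+1 <= logn 2 N)%N by rewrite -pfactor_dvdn.
have [c cop DN] := pfactor_coprime (isT : prime 2) N0.
rewrite DN totient_coprime; last by rewrite coprimeXr // coprime_sym.
have c0 : (0 < c)%N by case: (c) DN N0 => // ->.
case: (logn 2 N) Ne => // e' Ne.
rewrite totient_pfactor // mul1n -[leqLHS]mul1n leq_mul ?totient_gt0 //.
by rewrite leq_pexp2l.
Qed.

(** The order N of z divides 2T but not T. The odd part of N divides T, so N has strictly more
    factors 2 than T. Hence 2^(k+1) divides N and the degree phi(N) is at least 2^k. *)
Lemma size_minCpoly_pow_eqN1 k T (z : algC) : (2 ^ k %| T)%N -> (0 < T)%N ->
  z ^+ T = - 1 -> (k < (size (minCpoly z)).-1)%N.
Proof.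
move=> kT T0 zT.
have [N prN NT] : {N | N.-primitive_root z & (N %| 2 * T)%N}.
  apply: prim_order_exists; first by rewrite muln_gt0.
  by rewrite mulnC exprM zT sqrrN expr1n.
have nNT : ~~ (N %| T)%N.
  rewrite (prim_order_dvd prN) zT; apply/eqP => /eqP.
  by rewrite -subr_eq0 -opprD oppr_eq0 -(natrD _ 1 1) pnatr_eq0.
rewrite (minCpoly_cyclotomic prN) size_cyclotomic.
have N0 := prim_order_gt0 prN.
apply: leq_trans (ltn_expl k (isT : 1 < 2)%N) _ => /=.
apply: leq_totient_pow2 => //.
have [c cop DN] := pfactor_coprime (isT : prime 2) N0.
have [d copd DT] := pfactor_coprime (isT : prime 2) T0.
have kl : (k <= logn 2 T)%N by rewrite -pfactor_dvdn.
have cT : (c %| T)%N.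
  have : (c %| 2 * T)%N by apply: dvdn_trans NT; rewrite DN dvdn_mulr.
  by rewrite Gauss_dvdr // coprime_sym.
have ltl : (logn 2 T < logn 2 N)%N.
  rewrite ltnNge; apply: contra nNT => le.
  rewrite DN Gauss_dvd ?cT ?coprimeXr 1?coprime_sym //= DT dvdn_mull //.
  by rewrite dvdn_exp2l.
by rewrite DN dvdn_mull // dvdn_exp2l // (leq_ltn_trans kl).
Qed.

(** A Bezout relation u q + v (X^(m+1) + 1) = 1 over [algC], evaluated at the companion matrix,
    becomes u(C) q(C) = 1. *)
Lemma negadet_neq0 m (q : {poly int}) :
  (forall z : algC, root (map_poly intr q) z -> z ^+ m.+1 != - 1) ->
  negadet m q != 0.
Proof.
move=> qz; pose f : {rmorphism int -> algC} := intr.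
rewrite -(intr_eq0 algC) -[_%:~R]/(f _) -negadet_map; set h := map_poly f q.
have /Bezout_eq1_coprimepP [[u v] /= uv] : coprimep h ('X^(m.+1) + 1).
  apply/Pdiv.ClosedField.coprimepP => z /qz; apply: contra.
  by rewrite /root !hornerE addr_eq0.
have : horner_mx (negacyclic algC m) (u * h) = 1.
  have -> : u * h = 1 - v * ('X^(m.+1) + 1) by apply/eqP; rewrite eq_sym subr_eq uv.
  by rewrite rmorphB rmorphM rmorph1 /= horner_negacyclic mulr0 subr0.
move/(congr1 determinant); rewrite -/(negadet m _) negadetM det1.
by apply: contra_eq_neq => ->; rewrite mulr0 eq_sym oner_eq0.
Qed.

(** Induction on the degree, splitting off the minimal polynomial of one root at a time. The numbers
    r1, r2, r3 count the factors charged to each of the three integers. *)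
Lemma int_poly_small_degree_roots k m (q : {poly int}) : m.+1 = (2 ^ k)`! ->
  q != 0 ->
  (forall z : algC, root (map_poly intr q) z ->
     z != 0 /\ ((size (minCpoly z)).-1 <= k)%N) ->
  exists r1 r2 r3 : nat, [/\ ((size q).-1 <= k * (r1 + r2 + r3))%N,
    (2 ^+ r1 %| lead_coef q)%Z, (2 ^+ r2 %| q`_0)%Z & (2 ^+ r3 %| negadet m q)%Z].
Proof.
move=> Dm; have [N] := ubnP (size q); elim: N => // N IHN in q *.
rewrite ltnS => sqN q0 rq.
have [sq1|sq1] := leqP (size q) 1.
  exists 0%N, 0%N, 0%N; rewrite !expr0 !dvd1z; split=> //.
  by rewrite -subn1 (eqP (_ : (size q - 1)%N == 0%N)).
have fi := @intr_inj algC.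
have sqC : size (map_poly (intr : int -> algC) q) = size q.
  by apply: size_map_inj_poly => //; apply: fi.
have [z rz] : exists z : algC, root (map_poly intr q) z.
  by apply/closed_rootP; rewrite sqC neq_ltn sq1 orbT.
have [z0 kz] := rq z rz.
have [pz [Dpz mon_pz] dv_pz] := minCpolyP z.
have [mu [a a0 Dmu]] := rat_poly_scale pz.
have QC (p : {poly int}) : map_poly ratr (map_poly (intr : int -> rat) p) =
    map_poly (intr : int -> algC) p.
  by rewrite -map_poly_comp; apply: eq_map_poly => b; rewrite /= rmorph_int.
have muq : mu %| q.
  rewrite -dvdp_rat_int; move: rz; rewrite -QC dv_pz Dmu dvdpZl //.
  by rewrite invr_eq0 intr_eq0.
(* Gauss's lemma: the primitive multiple [nu] of the minimal polynomial of z divides q over the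
   integers, so all three integers attached to q factor accordingly. *)
have [q' Dq] := dvdpP_int muq.
set nu := zprimitive mu in Dq.
have nu_q0 : nu * q' != 0 by rewrite -Dq.
have [nu0 q'0] : nu != 0 /\ q' != 0.
  by move: nu_q0; rewrite mulf_eq0 negb_or => /andP.
have snu : size nu = size (minCpoly z).
  rewrite Dpz size_map_poly Dmu size_scale ?invr_eq0 ?intr_eq0 //.
  by rewrite size_rat_int_poly size_zprimitive.
have snu1 : (1 < size nu)%N by rewrite snu size_minCpoly.
have sq : size q = (size nu + size q').-1 by rewrite Dq size_mul.
have rootMl x : root (map_poly (intr : int -> algC) q') x -> root (map_poly intr q) x.
  by move=> xq'; rewrite Dq rmorphM rootM xq' orbT.
have [||r1 [r2 [r3 [sr d1 d2 d3]]]] := IHN q' _ q'0.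
- have ar (c d : nat) : (1 < c -> d < (c + d).-1)%N by clear; lia.
  by apply: leq_trans sqN; rewrite sq; apply: ar.
- by move=> x /rootMl /rq.
have snuk : (1 < size nu <= k.+1)%N.
  by rewrite snu1 snu (leq_trans (leqSpred _)) ?ltnS.
(* One more factor 2 in any of the three integers pays for deg nu <= k. *)
have key r : (r1 + r2 + r3 < r)%N -> ((size q).-1 <= k * r)%N.
  move=> lr; apply: leq_trans (leq_mul (leqnn k) lr); rewrite mulnS.
  have ar (c d e : nat) : (1 < c <= k.+1 -> d.-1 <= e -> (c + d).-1.-1 <= k + e)%N.
    by clear; lia.
  by rewrite sq; apply: ar.
have dvl : (2 ^+ r1 %| lead_coef q)%Z by rewrite Dq lead_coefM dvdz_mull.
have dv0 : (2 ^+ r2 %| q`_0)%Z by rewrite Dq coef0M dvdz_mull.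
have dvD : (2 ^+ r3 %| negadet m q)%Z by rewrite Dq negadetM dvdz_mull.
have [e1|ne1] := boolP (2 %| lead_coef nu)%Z.
  exists r1.+1, r2, r3; split=> //; first by apply: key; rewrite !(addSn, addnS).
  by rewrite exprS Dq lead_coefM dvdz_mul.
have [e2|ne2] := boolP (2 %| nu`_0)%Z.
  exists r1, r2.+1, r3; split=> //; first by apply: key; rewrite !(addSn, addnS).
  by rewrite exprS Dq coef0M dvdz_mul.
exists r1, r2, r3.+1; split=> //; first by apply: key; rewrite !(addSn, addnS).
by rewrite exprS Dq negadetM dvdz_mul // (@even_negadet k).
Qed.

(** * Finite index subgroups of Z^d *)

(** Pigeonhole for a relation, so that no matching function between systems of cosets has to be
    chosen. *)
Lemma rel_leq_size (A B : eqType) (r : A -> B -> Prop) (s : seq A) (t : seq B) :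
  uniq s -> (forall x, x \in s -> exists2 y, y \in t & r x y) ->
  (forall x x' y, x \in s -> x' \in s -> r x y -> r x' y -> x = x') ->
  (size s <= size t)%N.
Proof.
elim: s t => [|x s IHs] t //= /andP[xs us] ex inj.
have [y yt rxy] := ex x (mem_head _ _).
have -> : size t = (size (rem y t)).+1.
  by rewrite size_rem // prednK //; case: (t) yt.
rewrite ltnS; apply: IHs => //.
  move=> x' x's; have [|y' y't rx'y'] := ex x'; first by rewrite inE x's orbT.
  exists y' => //; move: y't; rewrite (perm_mem (perm_to_rem yt)) inE.
  case/orP=> // /eqP E; rewrite E in rx'y'.
  by rewrite (inj x x' y) ?mem_head ?inE ?x's ?orbT in xs.
by move=> a b c As Bs; apply: inj; rewrite inE ?As ?Bs orbT.
Qed.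

Section Transversal.
Variable V : zmodType.
Implicit Types (G H K : set V) (s t : seq V).

Definition subgroup H := H 0 /\ forall x y, H x -> H y -> H (x - y).

Lemma subgroupB H x y : subgroup H -> H x -> H y -> H (x - y).
Proof. by case=> _; apply. Qed.

Lemma subgroupN H x : subgroup H -> H x -> H (- x).
Proof. by case=> H0 HB Hx; rewrite -sub0r; apply: HB. Qed.

Lemma subgroupD H x y : subgroup H -> H x -> H y -> H (x + y).
Proof.
by move=> sH Hx Hy; rewrite -[y]opprK; apply: subgroupB => //; apply: subgroupN.
Qed.

Lemma subgroupMz H x (z : int) : subgroup H -> H x -> H (x *~ z).
Proof.
move=> sH Hx; case: z => n.
  elim: n => [|n IHn]; first by rewrite mulr0z; case: sH.
  by rewrite -[_ *~ _]/(x *+ n.+1) mulrS; apply: subgroupD.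
apply: subgroupN => //.
elim: n => [|n IHn] //; by rewrite mulrS; apply: subgroupD.
Qed.

(** The index [H : K] is handled as the size of such a list, without forming a quotient. *)
Definition coset_reps H K s :=
  [/\ uniq s, (forall x, x \in s -> H x),
      (forall x, H x -> exists2 y, y \in s & K (x - y)) &
      (forall x y, x \in s -> y \in s -> K (x - y) -> x = y)].

Lemma coset_reps_leq H K s t : subgroup K ->
  coset_reps H K s -> coset_reps H K t -> (size s <= size t)%N.
Proof.
move=> sK [us sH _ si] [_ _ tc _].
apply: (rel_leq_size (r := fun x y => K (x - y))) => //.
  by move=> x /sH /tc.
move=> x x' y xs x's Kx Kx'; apply: si => //.
have -> : x - x' = (x - y) - (x' - y) by rewrite opprB addrA subrK.
exact: subgroupB.
Qed.

Lemma coset_reps_size H K s t : subgroup K ->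
  coset_reps H K s -> coset_reps H K t -> size s = size t.
Proof.
by move=> sK Hs Ht; apply/eqP; rewrite eqn_leq !(@coset_reps_leq H K).
Qed.

(** On sizes this is [G : K] = [G : H] [H : K]. *)
Lemma coset_reps_mul G H K s t : subgroup G -> subgroup H -> subgroup K ->
  (forall x, H x -> G x) -> (forall x, K x -> H x) ->
  coset_reps H K s -> coset_reps G H t ->
  coset_reps G K [seq y + x | y <- t, x <- s].
Proof.
move=> sG sH sK HG KH [us sI sc si] [ut tI tc ti].
have inj y x y' x' : y \in t -> x \in s -> y' \in t -> x' \in s ->
    K (y + x - (y' + x')) -> y = y' /\ x = x'.
  move=> yt xs y't x's K1.
  have yy : y = y'.
    apply: ti => //; have -> : y - y' = (y + x - (y' + x')) - x + x'.
      by rewrite opprD addrACA -!addrA [- x' + _]addrCA addNr addr0 subrr addr0.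
    apply: subgroupD => //; last exact: sI.
    by apply: subgroupB => //; [apply: KH | apply: sI].
  split=> //; apply: si => //; move: K1.
  by rewrite yy opprD addrACA subrr add0r.
split.
- apply: allpairs_uniq => // -[y x] [y' x'] /allpairsP[[a b] [/= at_ bs [-> ->]]].
  case/allpairsP=> -[c e] [/= ct es [-> ->]] /= E.
  by have [] := inj a b c e at_ bs ct es; rewrite ?E ?subrr; [case: sK | move=> -> ->].
- move=> x /allpairsP[[a b] [/= at_ bs ->]].
  by apply: subgroupD => //; [apply: tI | apply: HG; apply: sI].
- move=> x Gx; have [y yt Hxy] := tc x Gx; have [z zs Kz] := sc _ Hxy.
  exists (y + z); first by apply/allpairsP; exists (y, z).
  by rewrite opprD addrA.
- move=> x y /allpairsP[[a b] [/= at_ bs ->]] /allpairsP[[c e] [/= ct es ->]] K1.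
  by have [-> ->] := inj a b c e at_ bs ct es K1.
Qed.

End Transversal.

Section Hermite.

(** The first coordinates of H form an ideal of the integers; c is its least positive element, and
    Euclidean division shows that it is a generator. *)
Lemma hermite_step d (H : set 'rV[int]_(1 + d)) (n : int) :
  subgroup H -> n != 0 -> (forall x, H (n *: x)) ->
  exists (c : nat) (v : 'rV[int]_(1 + d)),
    [/\ (0 < c)%N, H v, v ord0 ord0 = c & forall x, H x -> (c %| x ord0 ord0)%Z].
Proof.
move=> sH n0 nH.
have ex : exists c : nat, (0 < c)%N && `[< exists2 v, H v & v ord0 ord0 = c >].
  exists `|n|%N; rewrite absz_gt0 n0; apply/asboolP.
  exists (n *: (sgz n *: delta_mx 0 0)); first exact: nH.
  by rewrite !mxE !eqxx mulr1 mulrC -abszEsg.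
case: (ex_minnP ex) => c /andP[c0 /asboolP[v Hv vc]] cmin.
exists c, v; split=> // x Hx; apply: contraT => nz.
have r0 : (x ord0 ord0 %% c)%Z != 0.
  by apply: contra nz => /eqP /dvdz_mod0P.
have rge : 0 <= (x ord0 ord0 %% c)%Z by rewrite modz_ge0 // eqz_nat -lt0n.
have := cmin `|(x ord0 ord0 %% c)%Z|%N; rewrite absz_gt0 r0 /=.
suff -> : `[< exists2 v, H v & v ord0 ord0 = `|(x ord0 ord0 %% c)%Z|%N :> int >].
  move=> /(_ isT); rewrite leqNgt -ltz_nat gez0_abs // => /negP[].
  by rewrite ltz_pmod // ltz_nat.
apply/asboolP; exists (x - (x ord0 ord0 %/ c)%Z *: v).
  apply: subgroupB => //; rewrite -[(x ord0 ord0 %/ c)%Z]intz scaler_int.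
  exact: subgroupMz.
by rewrite !mxE vc gez0_abs // {1}(divz_eq (x ord0 ord0) c) addrC addKr.
Qed.

(** Let H0 be the part of H with first coordinate 0, with basis B0. A vector v of H with minimal
    first coordinate c > 0 completes it to a block triangular basis, so |det B| = c |det B0|. This
    is also the number of pairs of a residue below c and a representative modulo H0. *)
Lemma hermite d (H : set 'rV[int]_d) (n : int) :
  subgroup H -> n != 0 -> (forall x, H (n *: x)) ->
  exists B : 'M[int]_d,
    [/\ \det B != 0, (forall x, H x <-> exists y, x = y *m B)
      & exists2 s, coset_reps setT H s & size s = `|\det B|%N].
Proof.
elim: d => [|d IHd] in H n *.
  move=> [H0 _] _ _; exists 1; rewrite det1; split=> //.
    move=> x; split=> _; first by exists x; rewrite mulmx1.
    by rewrite [x]thinmx0.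
  exists [:: 0] => //; split=> //.
    by move=> x _; exists 0; rewrite ?mem_head // [x - 0]thinmx0.
  by move=> x y _ _ _; rewrite [x]thinmx0 [y]thinmx0.
rewrite -[d.+1]/(1 + d)%N in H *.
move=> sH n0 nH; have [c [v [c0 Hv vc cdiv]]] := hermite_step sH n0 nH.
have HZ z x : H x -> H (z *: x).
  by move=> Hx; rewrite -[z]intz scaler_int; apply: subgroupMz.
pose H0 : set 'rV[int]_d := [set y | H (row_mx 0 y)].
have sH0 : subgroup H0.
  split; first by rewrite /H0 /= row_mx0; case: sH.
  move=> x y Hx Hy; rewrite /H0 /= -(subrr 0) -add_row_mx -opp_row_mx.
  exact: subgroupB.
have nH0 x : H0 (n *: x) by rewrite /H0 /= -(scaler0 _ n) -scale_row_mx.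
have [B0 [dB0 HB0 [s0 [us0 _ s0c s0i] ss0]]] := IHd H0 n sH0 n0 nH0.
have vE : v = row_mx c%:Z%:M (rsubmx v).
  rewrite -[LHS]hsubmxK; congr row_mx; apply/rowP=> i.
  by rewrite !ord1 !mxE eqxx mulr1n -vc; congr (v _ _); apply: val_inj.
pose B : 'M[int]_(1 + d) := block_mx c%:Z%:M (rsubmx v) 0 B0.
have dB : \det B = c%:Z * \det B0.
  by rewrite det_ublock det_scalar expr1.
have lead_row (x : 'rV[int]_(1 + d)) : lsubmx x = (x ord0 ord0)%:M.
  by apply/rowP=> i; rewrite !ord1 !mxE eqxx mulr1n; congr (x _ _); apply: val_inj.
have red (x : 'rV[int]_(1 + d)) (q r : int) : x ord0 ord0 = q * c + r ->
    x - q *: v = row_mx r%:M (rsubmx (x - q *: v)).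
  move=> xE; rewrite -[LHS]hsubmxK lead_row; congr row_mx; congr _%:M.
  by rewrite !mxE vc xE addrC addKr.
exists B; split.
- by rewrite dB mulf_neq0 // eqz_nat -lt0n.
- move=> x; split=> [Hx|[y ->]].
    have /dvdzP[q xq] := cdiv _ Hx.
    have E := red x q 0; rewrite addr0 in E; have {}E := E xq.
    rewrite raddf0 in E.
    have : H0 (rsubmx (x - q *: v)).
      by rewrite /H0 /= -E; apply: subgroupB => //; apply: HZ.
    case/HB0=> y Hy; exists (row_mx q%:M y).
    rewrite mul_row_block mulmx0 addr0 -Hy -scalar_mxM mul_scalar_mx.
    rewrite -[x in LHS](subrK (q *: v)) {1}E {2}vE scale_row_mx add_row_mx add0r.
    by rewrite scale_scalar_mx addrC.
  rewrite -[y]hsubmxK lead_row mul_row_block mulmx0 addr0 -scalar_mxM mul_scalar_mx.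
  have -> : row_mx (y ord0 ord0 * c%:Z)%:M (y ord0 ord0 *: rsubmx v + rsubmx y *m B0) =
            y ord0 ord0 *: v + row_mx 0 (rsubmx y *m B0).
    by rewrite {2}vE scale_row_mx add_row_mx addr0 scale_scalar_mx.
  apply: subgroupD => //; first exact: HZ.
  by rewrite -/(H0 _); apply/HB0; exists (rsubmx y).
exists [seq row_mx (i%:Z)%:M y | i <- iota 0 c, y <- s0]; last first.
  by rewrite size_allpairs size_iota ss0 dB abszM.
have inj (i j : nat) (y z : 'rV[int]_d) : (i < c)%N -> (j < c)%N -> y \in s0 -> z \in s0 ->
   H (row_mx (i%:Z)%:M y - row_mx (j%:Z)%:M z) -> i = j /\ y = z.
  rewrite opp_row_mx add_row_mx -raddfB /= => ic jc ys zs HH.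
  have := cdiv _ HH.
  have -> : row_mx (i%:Z - j%:Z)%:M (y - z) ord0 ord0 = i%:Z - j%:Z.
    have -> : ord0 = lshift d ord0 :> 'I_(1 + d) by apply: val_inj.
    by rewrite row_mxEl mxE eqxx mulr1n.
  rewrite -eqz_mod_dvd !modz_nat eqz_nat !modn_small // => /eqP E.
  split=> //; apply: s0i => //.
  by move: HH; rewrite E subrr raddf0.
split.
- apply: allpairs_uniq => //; first exact: iota_uniq.
  move=> -[i y] [j z] /allpairsP[[a b] [/= + bs [-> ->]]] /allpairsP[[e f] [/= + fs [-> ->]]] /= E.
  rewrite !mem_iota !add0n => ia ie.
  by have [] := inj a e b f ia ie bs fs; rewrite ?E ?subrr; [case: sH | move=> -> ->].
- by [].
- move=> x _.
  have E := red x _ _ (divz_eq (x ord0 ord0) c).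
  set q := (x ord0 ord0 %/ c)%Z in E; set r := (x ord0 ord0 %% c)%Z in E.
  have rge : 0 <= r by rewrite modz_ge0 // eqz_nat -lt0n.
  have rlt : r < c by rewrite ltz_pmod // ltz_nat.
  have [y ys Hy] := s0c (rsubmx (x - q *: v)) I.
  exists (row_mx (`|r|%N%:Z)%:M y).
    apply/allpairsP; exists (`|r|%N, y); split=> //=.
    by rewrite mem_iota add0n -ltz_nat gez0_abs.
  rewrite gez0_abs // -[x in H (x - _)](subrK (q *: v)) E addrAC.
  apply: subgroupD => //; last exact: HZ.
  by rewrite opp_row_mx add_row_mx -raddfB /= subrr raddf0.
- move=> x y /allpairsP[[a b] [/= + bs ->]] /allpairsP[[e f] [/= + fs ->]] HH.
  by rewrite !mem_iota !add0n => ia ie; have [-> ->] := inj a e b f ia ie bs fs HH.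
Qed.

End Hermite.

(** * Embeddings and integral bases of number fields *)

(** If q has degree n + 1 and leading coefficient a, then a x is a root of a^n q(X / a), which is
    monic with integer coefficients. *)
Lemma int_root_integral_multiple (K : fieldType) (q : {poly int}) (x : K) :
  root (map_poly intr q) x -> integralOver (intr : int -> K) ((lead_coef q)%:~R * x).
Proof.
have [->|q0] := eqVneq q 0; first by rewrite lead_coef0 mul0r => _; apply: integral0.
move=> rx; set a := lead_coef q.
case Dn: (size q) => [|n]; first by move/eqP: Dn; rewrite size_poly_eq0 (negbTE q0).
case: n Dn => [|n] Dn.
  move: rx; rewrite (size1_polyC (eq_leq Dn)) map_polyC /= rootC => /eqP q00.
  have -> : a%:~R = 0 :> K by rewrite /a lead_coefE Dn.
  by rewrite mul0r; apply: integral0.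
pose h := \poly_(i < n.+2) (if i == n.+1 then 1 else q`_i * a ^+ (n - i)).
have sh : size h = n.+2 by apply: size_poly_eq; rewrite eqxx oner_eq0.
exists h; first by rewrite monicE lead_coefE sh coef_poly /= ltnSn eqxx.
have Dm p : map_poly (intr : int -> K) p = \poly_(i < size p) (p`_i)%:~R by [].
suff E : (map_poly intr h).[a%:~R * x] = a%:~R ^+ n * (map_poly intr q).[x].
  by rewrite rootE E (rootP rx) mulr0.
rewrite !Dm sh Dn !horner_poly mulr_sumr; apply: eq_bigr => i _.
rewrite coef_poly ltn_ord exprMn !mulrA; congr (_ * _).
case: eqP => [->|/eqP ni].
  by rewrite mul1r exprSr /a lead_coefE Dn.
have le : (i <= n)%N by rewrite -ltnS; have := ltn_ord i; rewrite ltnS leq_eqVlt (negbTE ni).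
by rewrite rmorphM rmorphXn /= -mulrA -exprD subnK // mulrC.
Qed.

Section NumberField.
Variable L : fieldExtType rat.

Lemma rat_algE (K : numFieldType) (s : {rmorphism L -> K}) (a : rat) :
  s (in_alg L a) = ratr a.
Proof. by rewrite -[LHS]/((s \o in_alg L) a) fmorph_eq_rat. Qed.

Lemma in_alg_int (z : int) : in_alg L z%:~R = z%:~R.
Proof. by rewrite rmorph_int. Qed.

Lemma integral_multiple (x : L) :
  exists2 c : int, c != 0 & integralOver (intr : int -> L) (c%:~R * x).
Proof.
have [/polyOver1P[p Dp] mp] := (minPolyOver 1 x, monic_minPoly 1 x).
have p0 : p != 0 by rewrite -(map_poly_eq0 (in_alg L)) -Dp monic_neq0.
have [q [a a0 Dq]] := rat_poly_scale p.
exists (lead_coef q).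
  by apply: contraNneq p0 => /eqP; rewrite Dq lead_coef_eq0 => /eqP->; rewrite rmorph0 scaler0.
apply: int_root_integral_multiple.
have := root_minPoly 1 x; rewrite Dp Dq linearZ /= rootZ; last first.
  by rewrite scaler_eq0 oner_eq0 orbF invr_eq0 intr_eq0.
by rewrite -map_poly_comp (@eq_map_poly _ _ _ intr) // => z; apply: in_alg_int.
Qed.

Lemma integral_primitive_element :
  exists2 t : L, integralOver (intr : int -> L) t & <<1; t>>%VS = {:L}%VS.
Proof.
have sep : separable 1 {:L}.
  apply/separableP=> u _; apply: pcharf0_separable => p.
  by rewrite (pchar_lalg L) pchar_num.
have gen := eq_adjoin_separable_generator sep (sub1v _).
set t := separable_generator _ _ in gen; have [c c0 ct] := integral_multiple t.
exists (c%:~R * t) => //; apply/eqP; rewrite eqEsubv subvf /= {1}gen.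
apply/FadjoinP; split; first exact: subv_adjoin.
have E : (c%:~R : rat)^-1 *: (c%:~R * t) = t.
  by rewrite -in_alg_int mulr_algl scalerA mulVf ?scale1r // intr_eq0.
by rewrite -[X in X \in _]E memvZ // memv_adjoin.
Qed.

Section Primitive.
Variables (t : L).
Hypothesis t_gen : <<1; t>>%VS = {:L}%VS.
Local Notation d := (\dim {:L}).

Definition evalgen (g : {poly rat}) : L := (map_poly (in_alg L) g).[t].

Lemma evalgenD g h : evalgen (g + h) = evalgen g + evalgen h.
Proof. by rewrite /evalgen rmorphD hornerD. Qed.
Lemma evalgenM g h : evalgen (g * h) = evalgen g * evalgen h.
Proof. by rewrite /evalgen rmorphM hornerM. Qed.
Lemma evalgenN g : evalgen (- g) = - evalgen g.
Proof. by rewrite /evalgen rmorphN hornerN. Qed.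
Lemma evalgen1 : evalgen 1 = 1.
Proof. by rewrite /evalgen rmorph1 hornerC. Qed.
Lemma evalgenX : evalgen 'X = t.
Proof. by rewrite /evalgen map_polyX hornerX. Qed.

Lemma generator_minpoly : exists mu : {poly rat},
  [/\ mu \is monic, size mu = d.+1, separable_poly mu
    & forall g, evalgen g = 0 <-> mu %| g].
Proof.
have [/polyOver1P[mu Dmu] mp] := (minPolyOver 1 t, monic_minPoly 1 t).
exists mu; split.
- by rewrite -(map_monic (in_alg L)) -Dmu.
- rewrite -(size_map_poly (in_alg L)) -Dmu size_minPoly.
  by have := dim_Fadjoin 1 t; rewrite t_gen dimv1 muln1 => ->.
- rewrite -(separable_map (in_alg L)) -Dmu.
  apply: pcharf0_separable => p.
  by rewrite (pchar_lalg L) pchar_num.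
- move=> g; rewrite -(dvdp_map (in_alg L)) -Dmu; split=> [g0|/dvdpP[h Dh]].
    apply: minPoly_dvdp; last by apply/rootP.
    by apply/polyOver1P; exists g.
  by rewrite /evalgen Dh hornerM minPolyxx mulr0.
Qed.

Lemma evalgen_surj (y : L) : exists2 g : {poly rat}, evalgen g = y & (size g <= d)%N.
Proof.
have : y \in <<1; t>>%VS by rewrite t_gen memvf.
case/Fadjoin_polyP=> _ /polyOver1P[g ->] Dy.
have [mu [mon smu _ kmu]] := generator_minpoly.
exists (g %% mu); last by rewrite -ltnS -smu ltn_modp monic_neq0.
have E : evalgen (g %/ mu * mu) = 0 by apply/kmu; rewrite dvdp_mull.
by rewrite Dy -/(evalgen g) {2}(divp_eq g mu) evalgenD E add0r.
Qed.

Lemma morph_evalgen (K : numFieldType) (s : {rmorphism L -> K}) g :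
  s (evalgen g) = (map_poly ratr g).[s t].
Proof.
rewrite /evalgen -horner_map -map_poly_comp; congr (_.[_]).
by apply: eq_map_poly => a; apply: rat_algE.
Qed.

(** The map g(t) |-> g(z) is well defined, since mu generates the relations of t and vanishes at
    z. *)
Lemma embedding_of_root (K : numFieldType) (z : K) (mu : {poly rat}) :
  (forall g, evalgen g = 0 <-> mu %| g) -> root (map_poly ratr mu) z ->
  exists s : {rmorphism L -> K}, s t = z.
Proof.
move=> kmu rz.
have [pol polK] : {pol : L -> {poly rat} & forall y, evalgen (pol y) = y}.
  by apply: (@choice _ _ (fun y g => evalgen g = y)) => y; have [g] := evalgen_surj y; exists g.
pose f (y : L) : K := (map_poly ratr (pol y)).[z].
have fE y g : evalgen g = y -> f y = (map_poly ratr g).[z].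
  move=> Dy; apply/eqP; rewrite -subr_eq0 -hornerN -hornerD -rmorphN -rmorphD /=.
  have : evalgen (pol y - g) = 0 by rewrite evalgenD evalgenN polK Dy subrr.
  case/kmu/dvdpP=> h ->; rewrite rmorphM hornerM /=.
  by rewrite (rootP rz) mulr0.
have fB : zmod_morphism f.
  move=> x y; rewrite (fE _ (pol x - pol y)) ?rmorphB ?hornerD ?hornerN //.
  by rewrite evalgenD evalgenN !polK.
have fM : monoid_morphism f.
  split; first by rewrite (fE _ 1) ?rmorph1 ?hornerC ?evalgen1.
  move=> x y; rewrite (fE _ (pol x * pol y)) ?rmorphM ?hornerM //.
  by rewrite evalgenM !polK.
pose s1 := GRing.isZmodMorphism.Build L K f fB.
pose s2 := GRing.isMonoidMorphism.Build L K f fM.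
pose s : {rmorphism L -> K} := HB.pack f s1 s2.
by exists s; rewrite /s /= (fE _ 'X) ?map_polyX ?hornerX // evalgenX.
Qed.

(** An embedding is determined by the image of t, and the separable minimal polynomial of t has d
    distinct roots in K. This serves both for [algC], where integrality is studied, and for [R[i]],
    where the height is defined. *)
Lemma embeddings_enum (K : numClosedFieldType) :
  exists s : 'I_d -> {rmorphism L -> K},
    injective (fun i => s i t) /\ (forall u : {rmorphism L -> K}, exists i, u =1 s i).
Proof.
have [mu [mon smu sep kmu]] := generator_minpoly.
have [r Dr] := closed_field_poly_normal (map_poly (ratr : rat -> K) mu).
have mon' : map_poly (ratr : rat -> K) mu \is monic by rewrite map_monic.
rewrite (monicP mon') scale1r in Dr.
have sr : size r = d.
  have := size_map_poly (ratr : {rmorphism rat -> K}) mu; rewrite /= Dr size_prod_XsubC smu.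
  by case.
have ur : uniq r by rewrite -separable_prod_XsubC -Dr separable_map.
have [s sE] : {s : 'I_d -> {rmorphism L -> K} & forall i, s i t = r`_i}.
  apply: (@choice _ _ (fun i (u : {rmorphism L -> K}) => u t = r`_(i : 'I_d))) => i.
  by apply: embedding_of_root kmu _; rewrite Dr root_prod_XsubC mem_nth // sr.
exists s; split.
  by move=> i j; rewrite !sE => /eqP; rewrite nth_uniq ?sr // => /eqP /val_inj.
move=> u; have : u t \in r.
  rewrite -root_prod_XsubC -Dr rootE -morph_evalgen.
  by rewrite (kmu mu).2 ?rmorph0 // dvdpp.
case/(nthP 0)=> i; rewrite sr => lti Di; exists (Ordinal lti) => y.
have [g <- _] := evalgen_surj y.
by rewrite !morph_evalgen sE /= Di.
Qed.

Definition lincomb (c : 'rV[rat]_d) : L := \sum_i c 0 i *: t ^+ i.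

Lemma lincombE c : lincomb c = evalgen (rVpoly c).
Proof.
rewrite /evalgen (horner_coef_wide _ (n := d)) ?size_map_poly ?size_poly //.
by apply: eq_bigr => i _; rewrite coef_map coef_rVpoly_ord mulr_algl.
Qed.

Lemma lincomb_surj x : exists c, x = lincomb c.
Proof.
have [g <- sg] := evalgen_surj x; exists (poly_rV g).
by rewrite lincombE poly_rV_K.
Qed.

Lemma lincomb_eq0 c : lincomb c = 0 -> c = 0.
Proof.
have [mu [mon smu _ kmu]] := generator_minpoly.
rewrite lincombE => /kmu dv; apply: (can_inj (@rVpolyK _ _)); rewrite raddf0.
apply/eqP; apply: contraTT dv => nz; apply/negP => /(dvdp_leq nz).
by rewrite smu leqNgt ltnS size_poly.
Qed.

Lemma morph_lincomb (K : numFieldType) (s : {rmorphism L -> K}) c :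
  s (lincomb c) = \sum_i ratr (c 0 i) * s t ^+ i.
Proof.
rewrite rmorph_sum; apply: eq_bigr => i _.
by rewrite -mulr_algl rmorphM rmorphXn -(rat_algE s).
Qed.

Lemma det_embeddings (K : numFieldType) (s : 'I_d -> {rmorphism L -> K}) :
  injective (fun i => s i t) -> \det (\matrix_(i < d, j < d) s j t ^+ i) != 0.
Proof.
move=> inj; have -> : \matrix_(i < d, j < d) s j t ^+ i = Vandermonde d (\row_j s j t).
  by apply/matrixP=> i j; rewrite !mxE.
rewrite det_Vandermonde; apply/prodf_neq0 => i _; apply/prodf_neq0 => j ij.
by rewrite !mxE subr_eq0; apply: contraTneq ij => /inj->; rewrite ltnn.
Qed.

Hypothesis t_int : integralOver (intr : int -> L) t.

Lemma Aint_embedding (s : {rmorphism L -> algC}) x :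
  integralOver (intr : int -> L) x -> s x \in Aint.
Proof.
case=> p mp rp; apply: (@root_monic_Aint (map_poly intr p)); last first.
- by apply/polyOverP=> i; rewrite coef_map rpred_int.
- by rewrite monic_map.
- rewrite -(fmorph_root s) -map_poly_comp in rp.
  by rewrite (eq_map_poly (g := intr)) // in rp => z; rewrite /= rmorph_int.
Qed.

(** Take for N minus the constant coefficient of the minimal polynomial X q(X) + p_0 of a: then N /
    a = q(a). *)
Lemma Aint_divides_int (a : algC) : a \in Aint -> a != 0 ->
  exists2 N : int, N != 0 & N%:~R / a \in Aint.
Proof.
move=> aI a0; have /floorpP[p Dp] := aI; have ra := root_minCpoly a.
have [pr [Dpr mpr] dv] := minCpolyP a.
pose q : {poly int} := \poly_(i < (size p).-1) p`_i.+1.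
have Dq : p = q * 'X + (p`_0)%:P.
  apply/polyP=> i; rewrite coefD coefMX coefC; case: i => [|i]; rewrite ?add0r //=.
  rewrite addr0 coef_poly; case: ltnP => // le.
  by rewrite nth_default //; move: le; case: (size p).
pose qC := map_poly (intr : int -> algC) q.
have E : qC.[a] * a + (p`_0)%:~R = 0.
  have := rootP ra; rewrite Dp [in LHS]Dq rmorphD rmorphM /= map_polyX map_polyC.
  by rewrite hornerD hornerMX hornerC.
have qI : qC.[a] \in Aint.
  apply: rpred_horner => //; apply/polyOverP=> i.
  by rewrite coef_map /= Aint_int.
exists (- p`_0); last first.
  have -> : (- p`_0)%:~R = qC.[a] * a.
    by apply/eqP; rewrite rmorphN /= eq_sym -addr_eq0 E.
  by rewrite mulfK.
(* If p_0 were 0, then a would be a root of q, of smaller degree than its minimal polynomial. *)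
rewrite oppr_eq0; apply/eqP => p00.
move/eqP: E; rewrite p00 addr0 mulf_eq0 (negbTE a0) orbF => E.
have QC : map_poly ratr (map_poly (intr : int -> rat) q) = qC.
  by rewrite -map_poly_comp; apply: eq_map_poly => b; rewrite /= rmorph_int.
have sp : size p = size pr.
  rewrite -(size_map_poly (ratr : {rmorphism rat -> algC}) pr) -Dpr Dp.
  by rewrite size_map_inj_poly //; apply: intr_inj.
have p0 : (0 < size p)%N by rewrite sp size_poly_gt0 monic_neq0.
have q0 : q != 0.
  apply: contraTneq p0 => q0; rewrite Dq q0 p00 mul0r add0r polyC0.
  by rewrite size_poly0.
have : root qC a by []; rewrite -QC dv => /dvdp_leq.
rewrite -(size_poly_eq0 (map_poly _ _)) size_rat_int_poly size_poly_eq0 => /(_ q0).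
by rewrite -sp leqNgt => /negP; apply; apply: leq_ltn_trans (size_poly _ _) _; rewrite ltn_predL.
Qed.

(* Cramer's rule for the Vandermonde system c |-> (s_j (lincomb c))_j; the
   determinant is an algebraic integer, hence divides a rational integer N. *)
Lemma integral_bounded_denominator : exists2 N : int, N != 0 &
  forall c, integralOver (intr : int -> L) (lincomb c) ->
    exists z : 'rV[int]_d, forall i, N%:~R * c 0 i = (z 0 i)%:~R.
Proof.
have [s [inj _]] := embeddings_enum algC.
set V := \matrix_(i < d, j < d) s j t ^+ i.
have V0 : \det V != 0 := det_embeddings inj.
have VI i j : V i j \in Aint by rewrite mxE rpredX // Aint_embedding.
have detI n (M : 'M[algC]_n) : (forall i j, M i j \in Aint) -> \det M \in Aint.
  move=> MI; rewrite rpred_sum // => u _; rewrite rpredM ?rpredX ?rpredN ?rpred1 //.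
  by rewrite rpred_prod.
have [N N0 NI] := Aint_divides_int (detI _ V VI) V0.
exists N => // c cI.
pose cC := map_mx (ratr : rat -> algC) c.
pose u : 'rV[algC]_d := \row_j s j (lincomb c).
have uE : u = cC *m V.
  apply/rowP=> j; rewrite !mxE morph_lincomb; apply: eq_bigr => i _.
  by rewrite !mxE.
have adjI i j : (\adj V) i j \in Aint.
  rewrite mxE /cofactor rpredM ?rpredX ?rpredN ?rpred1 //.
  by apply: detI => a b; rewrite !mxE rpredX // Aint_embedding.
have cE : \det V *: cC = u *m \adj V.
  by rewrite uE -mulmxA mul_mx_adj mul_mx_scalar.
suff H i : exists z : int, N%:~R * c 0 i = z%:~R.
  have [f fE] := choice H; exists (\row_i f i) => i; by rewrite mxE fE.
have Ic : (N%:~R * ratr (c 0 i) : algC) \in Num.int.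
  apply: Cint_rat_Aint.
    by rewrite rpredM ?rpred_int // Crat_rat.
  have -> : N%:~R * ratr (c 0 i) = (N%:~R / \det V) * (u *m \adj V) 0 i :> algC.
    by rewrite -cE !mxE [RHS]mulrA mulfVK.
  rewrite rpredM // mxE rpred_sum // => j _; rewrite rpredM // mxE.
  exact: Aint_embedding.
have : ratr (N%:~R * c 0 i) \in (Num.int : {pred algC}) by rewrite rmorphM rmorph_int.
by rewrite Cint_rat => /intrP[z Dz]; exists z.
Qed.

Lemma lincombD c c' : lincomb (c + c') = lincomb c + lincomb c'.
Proof. by rewrite -big_split; apply: eq_bigr => i _; rewrite mxE scalerDl. Qed.
Lemma lincombN c : lincomb (- c) = - lincomb c.
Proof. by rewrite -sumrN; apply: eq_bigr => i _; rewrite mxE scaleNr. Qed.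
Lemma lincombZ a c : lincomb (a *: c) = a *: lincomb c.
Proof. by rewrite scaler_sumr; apply: eq_bigr => i _; rewrite mxE scalerA. Qed.

Lemma lincomb_mulmx m (z : 'rV[rat]_m) (A : 'M_(m, d)) :
  lincomb (z *m A) = \sum_i z 0 i *: lincomb (row i A).
Proof.
rewrite mulmx_sum_row; elim/big_rec2: _ => [|i x y _ IH].
  by apply: big1 => i _; rewrite mxE scale0r.
by rewrite lincombD lincombZ IH.
Qed.

(** After scaling by N, the coordinate vectors of the integers form a subgroup of Z^d. It contains N
    Z^d because t is integral, so it has a basis B, and A = B / N. *)
Lemma integral_basis : exists2 A : 'M[rat]_d, \det A != 0 &
  (forall i, integralOver (intr : int -> L) (lincomb (row i A))) /\
  (forall x, integralOver (intr : int -> L) x ->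
     exists z : 'rV[int]_d, x = lincomb (map_mx intr z *m A)).
Proof.
have [N N0 Nden] := integral_bounded_denominator.
have N0r : (N%:~R : rat) != 0 by rewrite intr_eq0.
pose f (z : 'rV[int]_d) := lincomb ((N%:~R)^-1 *: map_mx intr z).
pose H : set 'rV[int]_d := [set z | integralOver (intr : int -> L) (f z)].
have sH : subgroup H.
  split.
    rewrite /H /= /f map_mx0 scaler0 (_ : lincomb 0 = 0); first exact: integral0.
    by apply: big1 => i _; rewrite mxE scale0r.
  move=> x y Hx Hy; rewrite /H /= /f map_mxD map_mxN scalerDr scalerN lincombD lincombN.
  exact: integral_sub.
have NH x : H (N *: x).
  rewrite /H /= /f map_mxZ scalerA mulVf // scale1r.
  rewrite /lincomb; apply: (big_ind (integralOver (intr : int -> L))).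
  - exact: integral0.
  - exact: integral_add.
  - move=> i _; rewrite mxE -mulr_algl -[_%:A]/(in_alg L _) in_alg_int; apply: integral_mul.
      exact: integral_id.
    elim: (i : nat) => [|j IHj]; first by rewrite expr0; apply: integral1.
    by rewrite exprS; apply: integral_mul.
have [B [dB HB _]] := hermite sH N0 NH.
exists ((N%:~R)^-1 *: map_mx intr B).
  by rewrite detZ mulf_neq0 ?expf_neq0 ?invr_eq0 // det_map_mx intr_eq0.
split.
  move=> i; have : H (row i B) by apply/HB; exists (delta_mx 0 i); rewrite -rowE.
  rewrite /H /= /f; congr integralOver; congr lincomb.
  by apply/rowP=> j; rewrite !mxE.
move=> x; have [c ->] := lincomb_surj x => xI.
have [z zE] := Nden c xI.
have zN : (N%:~R)^-1 *: map_mx intr z = c.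
  by apply/rowP=> i; rewrite !mxE -zE mulKf.
have /HB[y Hy] : H z by rewrite /H /= /f zN.
exists y; rewrite -zN Hy map_mxM -scalemxAr //.
Qed.

End Primitive.
End NumberField.

(** * Ideals of the ring of integers *)

Lemma ideal_norm_coset_reps (A : comNzRingType) (P : set A) (s : seq A) :
  subgroup P -> coset_reps setT P s -> ideal_norm P = size s.
Proof.
move=> sP [us _ sc si]; pose co (a : A) : set A := [set b | P (b - a)].
have coE a b : P (a - b) -> co a = co b.
  move=> Pab; apply/seteqP; split=> x; rewrite /co /= => Px.
    have -> : x - b = (x - a) + (a - b) by rewrite addrA subrK.
    exact: subgroupD.
  have -> : x - a = (x - b) - (a - b) by rewrite opprB addrA subrK.
  exact: subgroupB.
rewrite /ideal_norm.
have -> : [set [set b | P (b - a)] | a in @setT A] = [set` [fset x in map co s]%fset].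
  apply/seteqP; split=> X /=.
    case=> a _ <-; have [y ys Pay] := sc a I; rewrite !inE /=.
    by apply/mapP; exists y => //; apply: coE.
  by rewrite !inE /= => /mapP[y ys ->]; exists y.
rewrite set_fsetK card_fseq undup_id ?size_map // map_inj_in_uniq //.
move=> x y xs ys E; apply: si => //.
have : co x x by rewrite /co /= subrr; case: sP.
by rewrite E.
Qed.

Section Ideals.
Variable L : fieldExtType rat.
Local Notation O := (ringOfIntegers L).
Implicit Types (a b x y z : O) (I J P Q : set O) (g : L).

Definition isint (x : L) := integralOver (intr : int -> L) x.

Lemma int_val_isint a : isint (int_val a).
Proof. exact: (asboolW (int_valP a)). Qed.

Lemma isint_lift (x : L) : isint x -> exists a, int_val a = x.
Proof. by move=> /asboolP xI; exists (@RingOfIntegers L x xI). Qed.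

Lemma isintM (x y : L) : isint x -> isint y -> isint (x * y).
Proof. exact: integral_mul. Qed.
Lemma isintD (x y : L) : isint x -> isint y -> isint (x + y).
Proof. exact: integral_add. Qed.
Lemma int_val_inj : injective (@int_val L).
Proof. exact: val_inj. Qed.
Lemma int_valD a b : int_val (a + b) = int_val a + int_val b.
Proof. exact: (rmorphD (val : O -> L)). Qed.
Lemma int_valB a b : int_val (a - b) = int_val a - int_val b.
Proof. exact: (rmorphB (val : O -> L)). Qed.
Lemma int_valM a b : int_val (a * b) = int_val a * int_val b.
Proof. exact: (rmorphM (val : O -> L)). Qed.
Lemma int_val0 : int_val (0 : O) = 0.
Proof. exact: (rmorph0 (val : O -> L)). Qed.
Lemma int_val1 : int_val (1 : O) = 1.
Proof. exact: (rmorph1 (val : O -> L)). Qed.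
Lemma int_val_int (n : int) : int_val (n%:~R : O) = n%:~R.
Proof. exact: (rmorph_int (val : O -> L)). Qed.
Lemma int_val_sum (T : Type) (r : seq T) (F : T -> O) :
  int_val (\sum_(i <- r) F i) = \sum_(i <- r) int_val (F i).
Proof. exact: (rmorph_sum (val : O -> L)). Qed.
Lemma int_val_eq0 a : (int_val a == 0) = (a == 0).
Proof. by rewrite -int_val0 (inj_eq int_val_inj). Qed.

Lemma mulO_eq0 a b : a * b = 0 -> a = 0 \/ b = 0.
Proof.
move/(congr1 (@int_val L)); rewrite int_valM int_val0 => /eqP.
by rewrite mulf_eq0 !int_val_eq0 => /orP[]/eqP; [left | right].
Qed.

Lemma mulO_neq0 a b : a != 0 -> b != 0 -> a * b != 0.
Proof.
by move=> a0 b0; apply/eqP => /mulO_eq0[] E; [rewrite E eqxx in a0 | rewrite E eqxx in b0].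
Qed.

Lemma int_in_principal a : a != 0 -> exists2 c : int, c != 0 & exists b, a * b = c%:~R.
Proof.
move=> a0; have [c c0 /isint_lift[b Db]] := integral_multiple (int_val a)^-1.
exists c => //; exists b; apply: int_val_inj.
by rewrite int_valM Db mulrCA mulfV ?mulr1 ?int_val_int // int_val_eq0.
Qed.

(** Unlike [idealr_closed], this admits the whole ring, which a content ideal may be. *)
Definition idealset I := subgroup I /\ forall a x, I x -> I (a * x).
Definition principal a : set O := [set x | exists y, x = a * y].

Lemma ideal_principal a : idealset (principal a).
Proof.
split; first split.
- by exists 0; rewrite mulr0.
- by move=> _ _ [x ->] [y ->]; exists (x - y); rewrite mulrBr.
- by move=> b _ [y ->]; exists (b * y); rewrite mulrCA.
Qed.

Lemma ideal_mull I a x : idealset I -> I x -> I (a * x). Proof. by case=> _; apply. Qed.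
Lemma ideal_mulr I a x : idealset I -> I x -> I (x * a).
Proof. by move=> II Ix; rewrite mulrC; apply: ideal_mull. Qed.

Variables (n : nat) (w : 'I_n -> O).

Definition latcomb (z : 'rV[int]_n) : O := \sum_i w i *~ z 0 i.

Hypothesis w_span : forall x, exists z : 'rV_n, x = latcomb z.
Hypothesis w_free : forall z : 'rV_n, latcomb z = 0 -> z = 0.

Lemma latcombB (y z : 'rV_n) : latcomb (y - z) = latcomb y - latcomb z.
Proof.
by rewrite /latcomb -sumrB; apply: eq_bigr => i _; rewrite !mxE mulrzBr.
Qed.

Lemma latcombZ (c : int) (z : 'rV_n) : latcomb (c *: z) = latcomb z *~ c.
Proof.
rewrite /latcomb mulrz_suml; apply: eq_bigr => i _.
by rewrite mxE mulrC mulrzA.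
Qed.

Lemma lattice_index I (c : int) : subgroup I -> c != 0 -> (forall x, I (x *~ c)) ->
  exists B : 'M[int]_n, [/\ \det B != 0,
    (forall x, I x <-> exists y : 'rV_n, x = latcomb (y *m B))
    & exists2 s, coset_reps setT I s & size s = `|\det B|%N].
Proof.
move=> sI c0 cI; pose H : set 'rV[int]_n := [set z | I (latcomb z)].
have sH : subgroup H.
  split; last by move=> x y Hx Hy; rewrite /H /= latcombB; apply: subgroupB.
  rewrite /H /= /latcomb big1 => [|i _]; first by case: sI.
  by rewrite mxE mulr0z.
have cH (z : 'rV_n) : H (c *: z) by rewrite /H /= latcombZ; apply: cI.
have [B [dB HB [s [us _ sc si] ss]]] := hermite sH c0 cH.
have linj : injective latcomb.
  by move=> x y E; apply/eqP; rewrite -subr_eq0; apply/eqP/w_free; rewrite latcombB E subrr.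
exists B; split=> //.
  move=> x; have [z Dz] := w_span x; split=> [Ix|[y Dy]].
    have /HB[y Dy] : H z by rewrite /H /= -Dz.
    by exists y; rewrite -Dy.
  by rewrite Dy; apply/HB; exists y.
exists (map latcomb s); last by rewrite size_map.
split=> //.
- by rewrite map_inj_uniq.
- move=> x _; have [z ->] := w_span x; have [y ys Hzy] := sc z Logic.I.
  by exists (latcomb y); rewrite ?map_f // -latcombB.
- by move=> _ _ /mapP[x xs ->] /mapP[y ys ->]; rewrite -latcombB => /(si _ _ xs ys)->.
Qed.

(** A nonzero ideal contains a nonzero rational integer c, hence cO, and so has full rank. *)
Lemma ideal_index I a : idealset I -> I a -> a != 0 ->
  exists B : 'M[int]_n, [/\ \det B != 0,
    (forall x, I x <-> exists y : 'rV_n, x = latcomb (y *m B))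
    & exists2 s, coset_reps setT I s & size s = `|\det B|%N].
Proof.
move=> [sI mI] Ia a0; have [c c0 [b ab]] := int_in_principal a0.
apply: (lattice_index sI c0) => x.
by rewrite -mulrzr -ab mulrCA mulrC; apply: mI.
Qed.

(** Finiteness of O/aO, in the form used to show that elements are integral and that O/P is a
    field. *)
Lemma pigeonhole_mod a (e : nat -> O) : a != 0 ->
  exists i j, (i < j)%N /\ principal a (e j - e i).
Proof.
move=> a0; have aP : principal a a by exists 1; rewrite mulr1.
have [_ [_ _ [s [us _ sc si] _]]] := ideal_index (ideal_principal a) aP a0.
apply: contrapT => nex.
have sP := (ideal_principal a).1.
have : (size (iota 0 (size s).+1) <= size s)%N.
  apply: (rel_leq_size (r := fun i y => principal a (e i - y))); first exact: iota_uniq.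
    by move=> i _; apply: sc.
  move=> i j y _ _ Pi Pj; have [ij|ij|//] := ltngtP i j; case: nex.
    exists i, j; split=> //; have -> : e j - e i = (e j - y) - (e i - y).
      by rewrite opprB addrA subrK.
    exact: subgroupB.
  exists j, i; split=> //; have -> : e i - e j = (e i - y) - (e j - y).
    by rewrite opprB addrA subrK.
  exact: subgroupB.
by rewrite size_iota ltnn.
Qed.

(* Two of the g^i a agree modulo a, which gives a monic equation for g. *)
Lemma isint_pow_mul a g : a != 0 -> (forall i, isint (g ^+ i * int_val a)) -> isint g.
Proof.
move=> a0 H.
have [e eE] := choice (fun i => isint_lift (H i)).
have [i [j [ij [c Dc]]]] := pigeonhole_mod e a0.
have E : g ^+ j = g ^+ i + int_val c.
  have: int_val a != 0 by rewrite int_val_eq0.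
  move/mulfI; apply; apply/eqP; rewrite mulrDr addrC -subr_eq -int_valM -Dc int_valB !eE.
  by rewrite !(mulrC (int_val a)).
pose p : {poly L} := 'X^j - ('X^i + (int_val c)%:P).
have j0 : (0 < j)%N by apply: leq_ltn_trans ij.
have sq : (size ('X^i + (int_val c)%:P)%R < size ('X^j : {poly L}))%N.
  rewrite size_polyXn ltnS (leq_trans (size_polyD _ _)) // geq_max size_polyXn ij /=.
  by rewrite (leq_trans (size_polyC_leq1 _)).
apply: (@integral_root_monic int L intr g p).
- by rewrite monicE lead_coefDl ?size_polyN // lead_coefXn.
- by rewrite rootE !hornerE E subrr.
- move=> u /(nthP 0)[k _ <-]; rewrite /p !coefB coefD coefC !coefXn.
  apply: integral_sub; first exact: integral_nat.
  apply: integral_add; first exact: integral_nat.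
  by case: eqP => _; [apply: int_val_isint | apply: integral0].
Qed.

Definition primeset P := [/\ idealset P, ~ P 1, (forall x y, P (x * y) -> P x \/ P y)
   & exists2 a, P a & a != 0].

Lemma primesetP P : nonzero_prime_ideals P <-> primeset P.
Proof.
split.
  case=> [[P0 P1 PM] Pp Pa]; split=> //.
  - split; first split.
    + exact: set_mem P0.
    + move=> x y /mem_set Px /mem_set Py; apply: set_mem.
      by rewrite addrC -mulN1r; apply: (PM (-1) y x).
    + move=> a x /mem_set Px; apply: set_mem; rewrite -[a * x]addr0.
      exact: PM.
  - by move/mem_set; apply/negP.
  - by move=> x y /mem_set /Pp /orP[] /set_mem; [left | right].
case=> [[sP mP] P1 Pp Pa]; split=> //.
  split.
  - by apply: mem_set; case: sP.
  - by apply/negP => /set_mem.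
  - move=> a x y /set_mem Px /set_mem Py; apply: mem_set.
    by apply: subgroupD => //; apply: mP.
by move=> x y /set_mem /Pp[] /mem_set Pu; apply/orP; [left | right].
Qed.

(** Counting representatives modulo a is a strictly increasing bounded measure on the ideals
    containing a. It supplies the maximal elements that a Noetherian argument would give. *)
Lemma strict_ideal_count a s I J x : coset_reps setT (principal a) s ->
  idealset I -> idealset J -> I a -> (forall y, I y -> J y) -> J x -> ~ I x ->
  (count (fun t => `[< I t >]) s < count (fun t => `[< J t >]) s)%N.
Proof.
move=> [us _ sc _] II JI Ia IJ Jx nIx; have [y ys [z Dz]] := sc x Logic.I.
have Iz : I (x - y) by rewrite Dz; apply: ideal_mulr.
have Jy : J y.
  have -> : y = x - (x - y) by rewrite opprB addrC subrK.
  by apply: subgroupB; [case: JI | | apply: IJ].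
have nIy : ~ I y.
  move=> Iy; apply: nIx; rewrite -(subrK y x).
  by apply: subgroupD => //; case: II.
rewrite -[ltnRHS](size_filter) -size_filter.
have sub : {subset y :: [seq t <- s | `[< I t >]] <= [seq t <- s | `[< J t >]]}.
  move=> t; rewrite inE !mem_filter => /orP[/eqP->|/andP[/asboolP It ts]].
    by rewrite ys andbT; apply/asboolP.
  by rewrite ts andbT; apply/asboolP/IJ.
apply: (uniq_leq_size (s1 := y :: _)) sub; rewrite /= filter_uniq // andbT.
by rewrite mem_filter ys andbT; apply/asboolP.
Qed.

(** * Prime ideals and their valuations *)

Section PrimeIdeal.
Variable P : set O.
Hypothesis Pprime : primeset P.

Lemma prime_ideal : idealset P. Proof. by case: Pprime. Qed.
Lemma prime_sub : subgroup P. Proof. by case: prime_ideal. Qed.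

Lemma prime_pow x k : P (x ^+ k) -> P x.
Proof.
have [_ P1 Pp _] := Pprime.
elim: k => [|k IHk]; first by rewrite expr0 => /P1.
by rewrite exprS => /Pp[].
Qed.

(** Two powers of z agree modulo P; cancelling the smaller one gives z^l = 1 modulo P with l > 0. *)
Lemma prime_inverse z : ~ P z -> exists t, P (z * t - 1).
Proof.
have [PI P1 Pp [a Pa a0]] := Pprime => nPz.
have [i [j [ij [c Dc]]]] := pigeonhole_mod (fun i => z ^+ i) a0.
have : P (z ^+ i * (z ^+ (j - i) - 1)).
  rewrite mulrBr mulr1 -exprD subnKC ?(ltnW ij) // Dc; exact: ideal_mulr.
case/Pp=> [/prime_pow//|]; rewrite -[(j - i)%N]prednK ?subn_gt0 // exprS => H.
by eexists; apply: H.
Qed.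

(* Among the conductors (a : x) contained in P, a maximal one equals P. *)
Lemma prime_conductor a : P a -> a != 0 ->
  exists x, forall r, principal a (r * x) <-> P r.
Proof.
have [PI P1 Pp _] := Pprime => Pa a0.
have aI := ideal_principal a; have aP : principal a a by exists 1; rewrite mulr1.
have [_ [_ _ [s sT _]]] := ideal_index aI aP a0.
pose cond x : set O := [set r | principal a (r * x)].
have condI x : idealset (cond x).
  split; first split.
  - by rewrite /cond /= mul0r; case: aI => -[].
  - move=> r r' Hr Hr'; rewrite /cond /= mulrBl; apply: subgroupB => //.
    by case: aI.
  - by move=> b r Hr; rewrite /cond /= -mulrA; apply: ideal_mull.
have conda x : cond x a by exists x.
pose cnt x := count (fun t => `[< cond x t >]) s.
pose ok k := `[< exists2 x, (forall r, cond x r -> P r) & cnt x = k >].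
have ex : exists k, ok k.
  exists (cnt 1); apply/asboolP; exists 1 => // r [y]; rewrite mulr1 => ->.
  exact: ideal_mulr.
have bd k : ok k -> (k <= size s)%N.
  by move=> /asboolP[x _ <-]; apply: count_size.
case: (ex_maxnP ex bd) => k /asboolP[x xP Dk] kmax.
have max x' y : (forall r, cond x' r -> P r) -> (forall r, cond x r -> cond x' r) ->
    cond x' y -> cond x y.
  move=> x'P sub x'y; apply: contrapT => nxy.
  have := strict_ideal_count sT (condI x) (condI x') (conda x) sub x'y nxy.
  rewrite -/(cnt x) -/(cnt x') Dk ltnNge => /negP; apply; apply: kmax.
  by apply/asboolP; exists x'.
exists x => r; split; first exact: xP.
move=> Py; apply: contrapT => ny.
have sub y : forall r', cond x r' -> cond (y * x) r'.
  by move=> r' Hr; rewrite /cond /= mulrCA; apply: ideal_mull.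
have [H|] := pselect (forall r', cond (r * x) r' -> P r').
  (* Maximality gives (a : r x) = (a : x), so r cancels. Pigeonhole puts r^i (r^(j-i) - 1) in (a :
     x), hence r^(j-i) - 1 in P; since r is in P, so is 1. *)
  have canc k' u : cond x (r ^+ k' * u) -> cond x u.
    elim: k' => [|k' IHk]; first by rewrite expr0 mul1r.
    rewrite exprS -mulrA => Hu; apply: IHk; apply: max H (sub r) _.
    by rewrite /cond /= mulrCA mulrA.
  have [i [j [ij Dc]]] := pigeonhole_mod (fun i => r ^+ i * x) a0.
  have : cond x (r ^+ i * (r ^+ (j - i) - 1)).
    by rewrite /cond /= mulrBr mulr1 -exprD subnKC ?(ltnW ij) // mulrBl.
  move/canc/xP => H1; apply: P1.
  have -> : 1 = r ^+ (j - i) - (r ^+ (j - i) - 1) by rewrite opprB addrC subrK.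
  apply: subgroupB => //; first exact: prime_sub.
  by rewrite -[(j - i)%N]prednK ?subn_gt0 // exprS; apply: ideal_mulr.
(* Here t r x is in (a) for some t outside P. By primality (a : t x) is still contained in P, so by
   maximality it equals (a : x); but it contains r. *)
move=> /existsNP[t /not_implyP[tc nPt]].
apply: ny; apply: (max (t * x)) (sub t) _.
  by move=> u; rewrite /cond /= mulrA => /xP /Pp[].
by rewrite /cond /= mulrCA mulrA -mulrA.
Qed.

(** Take g = x / a, where the conductor (a : x) is P. Then g P consists of integers, g is not
    integral, and P + g P = O. *)
Lemma prime_uniformizer_inverse : exists g : L,
  [/\ ~ isint g, (forall u, P u -> isint (g * int_val u))
    & exists u v, [/\ P u, P v & 1 = int_val u + g * int_val v]].
Proof.
have [PI P1 Pp [a Pa a0]] := Pprime.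
have [x xE] := prime_conductor Pa a0.
have a0' : int_val a != 0 by rewrite int_val_eq0.
pose g := int_val x / int_val a.
have gP u : P u -> isint (g * int_val u).
  move/xE=> [y Dy]; have -> : g * int_val u = int_val y; last exact: int_val_isint.
  apply: (mulfI a0'); rewrite -int_valM -Dy int_valM /g mulrA mulrCA mulfV //.
  by rewrite mulr1 mulrC.
have gn : ~ isint g.
  move/isint_lift=> [y Dy]; apply: P1; apply/xE; exists y; rewrite mul1r.
  by apply: int_val_inj; rewrite int_valM Dy /g mulrCA mulfV // mulr1.
exists g; split=> //.
(* If g P were contained in P, every g^i a would be integral, and then g itself. So some z = g v
   lies outside P, and it is invertible modulo P. *)
have [v [Pv [z [Dz nPz]]]] : exists v, P v /\ exists z, int_val z = g * int_val v /\ ~ P z.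
  apply: contrapT => H; apply: gn; apply: (isint_pow_mul a0) => i.
  suff [b _ <-] : exists2 b, P b & int_val b = g ^+ i * int_val a by apply: int_val_isint.
  elim: i => [|i [b Pb Db]]; first by exists a; rewrite ?expr0 ?mul1r.
  have [c Dc] := isint_lift (gP b Pb); exists c; last by rewrite Dc Db exprS mulrA.
  by apply: contrapT => nPc; apply: H; exists b; split=> //; exists c.
have [t Ht] := prime_inverse nPz.
exists (- (z * t - 1)), (v * t); split.
- by apply: subgroupN => //; apply: prime_sub.
- exact: ideal_mulr.
- by rewrite opprB int_valB int_val1 !int_valM Dz mulrA subrK.
Qed.

(* Such a [g] behaves like the inverse of a uniformizer at P: multiplication by
   [g] lowers the valuation by 1, which turns ideal powers into integrality
   conditions on the [g ^+ i * a]. *)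
Section Uniformizer.
Variable g : L.
Hypothesis g_nint : ~ isint g.
Hypothesis g_mulP : forall u, P u -> isint (g * int_val u).
Hypothesis g_inv : exists u v, [/\ P u, P v & 1 = int_val u + g * int_val v].

(** For the converse, a = u a + v (g a) with u, v in P, and both a and g a lie in P^m by
    induction. *)
Lemma ideal_expE m a :
  ideal_exp P m a <-> forall i, (i <= m)%N -> isint (g ^+ i * int_val a).
Proof.
elim: m a => [|m IHm] a.
  split=> // _ i; rewrite leqn0 => /eqP->; rewrite expr0 mul1r.
  exact: int_val_isint.
split=> [[s [sP ->]] i lei|H].
  rewrite int_val_sum mulr_sumr big_seq.
  apply: (big_ind isint); [exact: integral0 | exact: isintD |].
  move=> t /sP[Pt1 /IHm Pt2]; rewrite int_valM.
  case: i lei => [|i] lei.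
    by rewrite expr0 mul1r; apply: isintM; apply: int_val_isint.
  by rewrite exprS mulrACA; apply: isintM; [apply: g_mulP | apply: Pt2].
have [u [v [Pu Pv E]]] := g_inv.
have [b Db] : exists b, int_val b = g * int_val a by apply: isint_lift; apply: (H 1%N).
exists [:: (u, a); (v, b)]; split.
  move=> t; rewrite !inE => /orP[]/eqP-> /=; split=> //.
    by apply/IHm => i lei; apply: H; apply: leqW.
  by apply/IHm => i lei; rewrite Db mulrA -exprSr; apply: H.
apply: int_val_inj; rewrite big_cons big_seq1 int_valD !int_valM /= Db.
by rewrite [_ * (g * _)]mulrCA mulrA -mulrDl -E mul1r.
Qed.

Lemma ideal_exp_le m k a : (k <= m)%N -> ideal_exp P m a -> ideal_exp P k a.
Proof.
by move=> km /ideal_expE H; apply/ideal_expE => i ik; apply: H; apply: leq_trans ik km.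
Qed.

Lemma ideal_expD m a b : ideal_exp P m a -> ideal_exp P m b -> ideal_exp P m (a + b).
Proof.
move=> /ideal_expE Ha /ideal_expE Hb; apply/ideal_expE => i im.
by rewrite int_valD mulrDr; apply: isintD; [apply: Ha | apply: Hb].
Qed.

Lemma ideal_exp_mull m a b : ideal_exp P m b -> ideal_exp P m (a * b).
Proof.
move=> /ideal_expE Hb; apply/ideal_expE => i im.
by rewrite int_valM mulrCA; apply: isintM; [apply: int_val_isint | apply: Hb].
Qed.

Lemma ideal_expMD m k a b :
  ideal_exp P m a -> ideal_exp P k b -> ideal_exp P (m + k) (a * b).
Proof.
move=> /ideal_expE Ha /ideal_expE Hb; apply/ideal_expE => i im.
have -> : i = (minn i m + (i - minn i m))%N by rewrite subnKC // geq_minl.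
rewrite int_valM exprD mulrACA; apply: isintM; first by apply: Ha; rewrite geq_minr.
by apply: Hb; lia.
Qed.

Lemma ideal_exp_g m a b : int_val b = g * int_val a ->
  ideal_exp P m b <-> ideal_exp P m.+1 a.
Proof.
move=> Db; split=> /ideal_expE H; apply/ideal_expE => i im.
  case: i im => [|i] im; first by rewrite expr0 mul1r; apply: int_val_isint.
  by rewrite exprSr -mulrA -Db; apply: H.
by rewrite Db mulrA -exprSr; apply: H.
Qed.

Lemma ideal_exp1 a : ideal_exp P 1 a <-> P a.
Proof.
split=> [[s [sP ->]]|Pa].
  rewrite big_seq; apply: (big_ind P).
  - by case: prime_sub.
  - by move=> x y; apply: subgroupD; apply: prime_sub.
  - by move=> t /sP[Pt _]; apply: ideal_mulr => //; apply: prime_ideal.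
by exists [:: (a, 1)]; split=> [t|]; rewrite ?big_seq1 ?mulr1 // inE => /eqP->.
Qed.

(* [a] has valuation [m] at [P] *)
Definition vspec a m := ideal_exp P m a /\ ~ ideal_exp P m.+1 a.

Lemma vspec_shift a m : vspec a m ->
  exists2 b, int_val b = g ^+ m * int_val a & ~ P b.
Proof.
case=> /ideal_expE H nH; have [b Db] := isint_lift (H m (leqnn m)).
exists b => // Pb; apply: nH; apply/ideal_expE => i.
rewrite leq_eqVlt => /orP[/eqP->|]; last exact: H.
by rewrite exprS -mulrA -Db; apply: g_mulP.
Qed.

Lemma nonmember_g a : ~ P a -> ~ isint (g * int_val a).
Proof.
move=> nPa /isint_lift[b Db]; apply/nPa/ideal_exp1/(ideal_exp_g 0 Db).
by [].
Qed.

(** The elements g^m a and g^k b lie outside P, hence so does their product, and g times an element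
    outside P is not integral. *)
Lemma vspecM a b m k : vspec a m -> vspec b k -> vspec (a * b) (m + k).
Proof.
move=> va vb; split; first by apply: ideal_expMD; [case: va | case: vb].
have [a' Da' nPa] := vspec_shift va; have [b' Db' nPb] := vspec_shift vb.
have nPab : ~ P (a' * b') by case: Pprime => _ _ Pp _ /Pp[].
move=> /ideal_expE /(_ _ (leqnn _)) H; apply: nonmember_g nPab _.
by rewrite int_valM Da' Db' mulrACA -int_valM -exprD mulrA -exprS.
Qed.

Lemma vspec_uniq a m k : vspec a m -> vspec a k -> m = k.
Proof.
move=> [am nam] [ak nak]; have [lt|lt|//] := ltngtP m k.
  by case: nam; apply: ideal_exp_le ak.
by case: nak; apply: ideal_exp_le am.
Qed.

Lemma exists_not_exp a : a != 0 -> exists m, ~ ideal_exp P m a.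
Proof.
move=> a0; apply: contrapT => /forallNP H; apply: g_nint.
apply: (isint_pow_mul a0) => i; have /contrapT/ideal_expE := H i; exact.
Qed.

Lemma vspec_ex a : a != 0 -> exists m, vspec a m.
Proof.
move=> /exists_not_exp[m Hm].
have ex : exists m, `[< ~ ideal_exp P m a >] by exists m; apply/asboolP.
case: (ex_minnP ex) => -[|k] /asboolP nk kmin; first by case: nk.
exists k; split=> //; apply: contrapT => nk'.
by have := kmin k; rewrite ltnn; move=> /(_ (asboolT nk')).
Qed.

Lemma ord_integer_vspec a m : vspec a m -> ord_integer P a = m.
Proof.
move=> va; rewrite /ord_integer; apply: xget_unique => //.
by move=> k vk; apply: vspec_uniq vk va.
Qed.

Lemma ord_vspec a b m k : vspec a m -> vspec b k ->
  ord P (int_val a / int_val b) = m%:Z - k%:Z.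
Proof.
have v0 x l : vspec x l -> x != 0.
  move=> [_ nx]; apply: contra_not_neq nx => ->; apply/ideal_expE => i _.
  by rewrite int_val0 mulr0; apply: integral0.
move=> va vb; have b0 := v0 _ _ vb; have a0 := v0 _ _ va.
rewrite /ord; apply: xget_unique.
  by exists a, b; rewrite !(ord_integer_vspec va, ord_integer_vspec vb).
move=> _ [a' [b' [b'0 E ->]]].
have E' : a * b' = a' * b.
  apply: int_val_inj; rewrite !int_valM; apply/eqP.
  by rewrite -eqr_div ?int_val_eq0 // E.
have a'0 : a' != 0.
  by apply: contra_eq_neq E' => ->; rewrite mul0r mulO_neq0.
have [m' va'] := vspec_ex a'0; have [k' vb'] := vspec_ex b'0.
have H := vspec_uniq (vspecM va vb'); rewrite E' in H.
have {}H := H _ (vspecM va' vb).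
by rewrite (ord_integer_vspec va') (ord_integer_vspec vb'); lia.
Qed.

(** Locally at P, y divides z: the quotient is s / t with t outside P. *)
Lemma vspec_frac y z m : vspec y m -> ideal_exp P m z ->
  exists s t, ~ P t /\ t * z = s * y.
Proof.
move=> vy /ideal_expE /(_ _ (leqnn _)) /isint_lift[s Ds].
have [t Dt nPt] := vspec_shift vy; exists s, t; split=> //.
by apply: int_val_inj; rewrite !int_valM Ds Dt mulrAC.
Qed.

Lemma vspec_nonmember a : ~ P a -> vspec a 0.
Proof. by move=> nPa; split=> // /ideal_exp1. Qed.

Lemma ideal_exp_cancel m s z : ~ P s -> ideal_exp P m (s * z) -> ideal_exp P m z.
Proof.
move=> nPs H; have [->|z0] := eqVneq z 0.
  by apply/ideal_expE => i _; rewrite int_val0 mulr0; apply: integral0.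
have [k vz] := vspec_ex z0; have [_ nH] := vspecM (vspec_nonmember nPs) vz.
rewrite add0n in nH; have [mk|km] := leqP m k.
  by apply: ideal_exp_le mk _; case: vz.
by case: nH; apply: ideal_exp_le H.
Qed.

(** m is the least valuation at P of an element of I; for a nonzero ideal it is the exponent of P in
    I. *)
Definition vspec_ideal I m :=
  (forall a, I a -> ideal_exp P m a) /\ exists2 a, I a & ~ ideal_exp P m.+1 a.

Lemma vspec_ideal_uniq I m k : vspec_ideal I m -> vspec_ideal I k -> m = k.
Proof.
move=> [Im [a Ia am]] [Ik [b Ib bk]]; have [lt|lt|//] := ltngtP m k.
  by case: am; apply: ideal_exp_le lt (Ik _ Ia).
by case: bk; apply: ideal_exp_le lt (Im _ Ib).
Qed.

Lemma vspec_ideal_ex I a : I a -> a != 0 -> exists m, vspec_ideal I m.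
Proof.
move=> Ia a0.
have ex : exists m, `[< exists2 b, I b & ~ ideal_exp P m b >].
  by have [m am] := exists_not_exp a0; exists m; apply/asboolP; exists a.
case: (ex_minnP ex) => -[|m] /asboolP[b Ib bm] mmin; first by case: bm.
exists m; split; last by exists b.
move=> c Ic; apply: contrapT => nc.
have /mmin : `[< exists2 b, I b & ~ ideal_exp P m b >] by apply/asboolP; exists c.
by rewrite ltnn.
Qed.

Lemma prime_ideal_index_gt1 s : coset_reps setT P s -> (1 < size s)%N.
Proof.
move=> [us _ sc _]; have [_ P1 _ _] := Pprime.
have [x xs Px] := sc 0 Logic.I; have [y ys Py] := sc 1 Logic.I.
have xy : x != y.
  apply: contra_not_neq P1 => E; rewrite -(subrK y 1).
  apply: subgroupD => //; first exact: prime_sub.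
  by rewrite -E -[x]opprK -[- x]sub0r; apply: subgroupN => //; apply: prime_sub.
apply: (@uniq_leq_size _ [:: x; y]); first by rewrite /= inE xy.
by move=> z; rewrite !inE => /orP[]/eqP->.
Qed.

Section Step.
Variable I : set O.
Hypothesis I_ideal : idealset I.
Hypothesis I_sub : forall x, I x -> P x.
(* P^-1 I = I + g I *)
Definition quot_ideal : set O :=
  [set z | exists i j, [/\ I i, I j & int_val z = int_val i + g * int_val j]].

Let sI : subgroup I. Proof. by case: I_ideal. Qed.

Lemma quot_ideal_ideal : idealset quot_ideal.
Proof.
split; first split.
- exists 0, 0; case: sI => I0 _; split=> //.
  by rewrite !int_val0 mulr0 addr0.
- move=> x y [i [j [Ii Ij Dx]]] [i' [j' [Ii' Ij' Dy]]].
  exists (i - i'), (j - j'); split; try exact: subgroupB.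
  by rewrite !int_valB Dx Dy mulrBr opprD addrACA.
- move=> a x [i [j [Ii Ij Dx]]]; exists (a * i), (a * j); split; try exact: ideal_mull.
  by rewrite !int_valM Dx mulrDr [X in _ + X = _]mulrCA.
Qed.

Lemma sub_quot_ideal x : I x -> quot_ideal x.
Proof.
move=> Ix; exists x, 0; case: (sI) => I0 _; split=> //.
by rewrite int_val0 mulr0 addr0.
Qed.

Lemma prime_mul_quot_ideal r z : P r -> quot_ideal z -> I (r * z).
Proof.
move=> Pr [i [j [Ii Ij Dz]]]; have [r' Dr'] := isint_lift (g_mulP Pr).
have -> : r * z = r * i + r' * j.
  by apply: int_val_inj; rewrite int_valD !int_valM Dz Dr' mulrDr mulrCA !mulrA.
by apply: subgroupD => //; apply: ideal_mull.
Qed.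

Lemma vspec_quot_ideal m : vspec_ideal I m ->
  [/\ (0 < m)%N, vspec_ideal quot_ideal m.-1 & exists2 z, quot_ideal z & vspec z m.-1].
Proof.
move=> [Im [y Iy ny]].
have m0 : (0 < m)%N.
  by rewrite lt0n; apply: contra_not_neq ny => ->; apply/ideal_exp1/I_sub.
have [z Dz] := isint_lift (g_mulP (I_sub Iy)).
have qz : quot_ideal z.
  exists 0, y; case: (sI) => I0 _; split=> //.
  by rewrite int_val0 add0r.
have vz : vspec z m.-1.
  split; first by apply/(ideal_exp_g _ Dz); rewrite prednK //; apply: Im.
  by rewrite prednK // => /(ideal_exp_g _ Dz).
split=> //; last by exists z.
split; last by exists z => //; case: vz.
move=> x [i [j [Ii Ij Dx]]].
have [j' Dj'] := isint_lift (g_mulP (I_sub Ij)).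
have -> : x = i + j' by apply: int_val_inj; rewrite int_valD Dx Dj'.
apply: ideal_expD; first by apply: ideal_exp_le (leq_pred m) (Im _ Ii).
by apply/(ideal_exp_g _ Dj'); rewrite prednK //; apply: Im.
Qed.

(** If z0 has the least valuation in P^-1 I, then x |-> x z0 induces a bijection from O/P to P^-1 I
    / I. *)
Lemma quot_ideal_index m r : vspec_ideal I m -> coset_reps setT P r ->
  exists2 s, coset_reps quot_ideal I s & size s = size r.
Proof.
move=> vI [ur _ rc ri]; have [m0 [vq _] [z0 qz0 vz0]] := vspec_quot_ideal vI.
have key x : I (x * z0) -> P x.
  move=> Ix; apply: contrapT => nPx.
  have [_] := vspecM (vspec_nonmember nPx) vz0; rewrite add0n prednK //.
  by case; apply: vI.1.
have inj x y : x \in r -> y \in r -> I (x * z0 - y * z0) -> x = y.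
  by move=> xr yr; rewrite -mulrBl => /key /(ri _ _ xr yr).
exists [seq x * z0 | x <- r]; last by rewrite size_map.
have qI := quot_ideal_ideal; split.
- rewrite map_inj_in_uniq // => x y xr yr E; apply: inj => //.
  by rewrite E subrr; case: sI.
- by move=> _ /mapP[x _ ->]; apply: ideal_mull.
(* Locally z' is the multiple s / t of z0. Replacing 1 / t by an inverse t' modulo P changes z' by
   an element of P times P^-1 I, which lies in I. *)
- move=> z' qz'; have [s [t [nPt E]]] := vspec_frac vz0 (vq _ qz').
  have [t' Pt'] := prime_inverse nPt.
  have [x xr Px] := rc (t' * s) Logic.I.
  exists (x * z0); first by apply: map_f.
  have -> : z' - x * z0 = (t' * s - x) * z0 - (t * t' - 1) * z'.
    rewrite !mulrBl mul1r opprB [RHS]addrC -[t' * s * z0]mulrA -E.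
    by rewrite mulrA [t' * t]mulrC addrA subrK.
  by apply: subgroupB => //; apply: prime_mul_quot_ideal.
- by move=> _ _ /mapP[x xr ->] /mapP[y yr ->] /inj->.
Qed.

End Step.
End Uniformizer.
End PrimeIdeal.

(** A proper ideal over I with the largest count modulo a is maximal, hence prime. *)
Lemma exists_prime_over I a : idealset I -> I a -> a != 0 -> ~ I 1 ->
  exists2 P, primeset P & forall x, I x -> P x.
Proof.
move=> II Ia a0 I1; have aI := ideal_principal a.
have aP : principal a a by exists 1; rewrite mulr1.
have [_ [_ _ [s sT _]]] := ideal_index aI aP a0.
pose good J := [/\ idealset J, (forall x, I x -> J x) & ~ J 1].
pose cnt J := count (fun t => `[< J t >]) s.
pose ok k := `[< exists2 J, good J & cnt J = k >].
have ex : exists k, ok k by exists (cnt I); apply/asboolP; exists I.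
have bd k : ok k -> (k <= size s)%N by move=> /asboolP[x _ <-]; apply: count_size.
case: (ex_maxnP ex bd) => k /asboolP[P [PI IP P1] Dk] kmax.
have sP : subgroup P by case: PI.
exists P => //; split=> //; last by exists a => //; apply: IP.
move=> x y Pxy; apply: contrapT => /not_orP[nx ny]; apply: ny.
pose J : set O := [set z | exists p r, P p /\ z = p + x * r].
have JI : idealset J.
  split; first split.
  - by exists 0, 0; rewrite mulr0 addr0; split=> //; case: sP.
  - move=> _ _ [p [r [Pp ->]]] [p' [r' [Pp' ->]]].
    exists (p - p'), (r - r'); split; first exact: subgroupB.
    by rewrite mulrBr opprD addrACA.
  - move=> b _ [p [r [Pp ->]]]; exists (b * p), (b * r).
    by split; [apply: ideal_mull | rewrite mulrDr [X in _ + X = _]mulrCA].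
have PJ z : P z -> J z by move=> Pz; exists z, 0; rewrite mulr0 addr0.
have Jx : J x by exists 0, 1; rewrite mulr1 add0r; split=> //; case: sP.
have J1 : J 1.
  apply: contrapT => nJ1.
  have := strict_ideal_count sT PI JI (IP _ Ia) PJ Jx nx.
  rewrite -/(cnt P) -/(cnt J) Dk ltnNge => /negP; apply; apply: kmax.
  by apply/asboolP; exists J => //; split=> // z /IP /PJ.
have [p [r [Pp E]]] := J1; rewrite -[y]mul1r E mulrDl mulrAC.
by apply: subgroupD => //; apply: ideal_mulr.
Qed.

Lemma prime_maximal P Q : primeset P -> primeset Q -> (forall x, P x -> Q x) -> P = Q.
Proof.
move=> Pp Qp PQ; apply/seteqP; split=> x; first exact: PQ.
move=> Qx; apply: contrapT => nPx; have [t Ht] := prime_inverse Pp nPx.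
have [QI Q1 _ _] := Qp; apply: Q1.
have -> : 1 = x * t - (x * t - 1) by rewrite opprB addrC subrK.
apply: subgroupB; [by case: QI | exact: ideal_mulr | exact: PQ].
Qed.

(** Induction on [O : I]: for a prime P over I, passing to P^-1 I divides the index by [O : P] > 1
    and lowers only the valuation at P. The factorization is recorded by valuations and index, the
    two quantities that enter the height. *)
Theorem ideal_factorization I a : idealset I -> I a -> a != 0 ->
  exists s : seq (set O), [/\ (forall Q, Q \in s -> primeset Q),
    (forall Q, primeset Q -> vspec_ideal Q I (count_mem Q s))
    & exists2 t, coset_reps setT I t & size t = (\prod_(Q <- s) ideal_norm Q)%N].
Proof.
move=> II Ia a0; have [_ [_ _ [t0 t0T _]]] := ideal_index II Ia a0.
have [k] := ubnP (size t0); elim: k => // k IHk in I a II Ia a0 t0 t0T *.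
rewrite ltnS => sk; have sI : subgroup I by case: II.
have [I1|nI1] := pselect (I 1).
  have IT x : I x by rewrite -[x]mulr1; apply: ideal_mull.
  exists [::]; split=> //.
    move=> Q Qp; split=> //; exists 1 => //.
    have [_ Q1 _ _] := Qp; by move/(ideal_exp1 Qp).
  exists [:: 0]; last by rewrite big_nil.
  split=> //; first by move=> x _; exists 0; rewrite ?mem_head.
  by move=> x y; rewrite !inE => /eqP-> /eqP->.
have [P Pp IP] := exists_prime_over II Ia a0 nI1.
have [g [gn gP ginv]] := prime_uniformizer_inverse Pp.
have [m vI] := vspec_ideal_ex gn gP ginv Ia a0.
have [m0 vq _] := vspec_quot_ideal Pp gP ginv II IP vI.
have qI := quot_ideal_ideal g II.
have Iq := sub_quot_ideal g II.
have [_ [_ _ [r rT _]]] := ideal_index (prime_ideal Pp) (IP _ Ia) a0.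
have [s1 s1T ss1] := quot_ideal_index Pp gP ginv II IP vI rT.
have [_ [_ _ [t1 t1T _]]] := ideal_index qI (Iq _ Ia) a0.
have sq : subgroup (quot_ideal g I) by case: qI.
have sTT : subgroup (setT : set O) by [].
have sz t : coset_reps setT (quot_ideal g I) t -> size t0 = (size t * size r)%N.
  move=> tT; rewrite -ss1 -(size_allpairs (fun y x => y + x)).
  apply: coset_reps_size t0T _ => //.
  exact: (coset_reps_mul (G := setT) (H := quot_ideal g I)).
have r2 := prime_ideal_index_gt1 Pp rT.
have t1k : (size t1 < k)%N.
  apply: leq_trans sk; rewrite (sz _ t1T) ltn_Pmulr //.
  have [_ _ tc _] := t1T; have [x + _] := tc 0 Logic.I; by case: (t1).
have [s [sp sv [t tT st]]] := IHk _ a qI (Iq _ Ia) a0 t1 t1T t1k.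
exists (P :: s); split.
- by move=> Q; rewrite inE => /orP[/eqP->|/sp].
- move=> Q Qp /=.
  have [gQ [gQn gQP gQinv]] := prime_uniformizer_inverse Qp.
  have [PQ|PQ] := eqVneq P Q.
    rewrite -PQ add1n.
    have -> : count_mem P s = m.-1.
      by apply: (vspec_ideal_uniq gP ginv) vq; apply: sv.
    by rewrite prednK.
  rewrite add0n.
  have [l vQ] := vspec_ideal_ex gQn gQP gQinv Ia a0.
  suff vQ' : vspec_ideal Q (quot_ideal g I) l.
    by rewrite -(vspec_ideal_uniq gQP gQinv vQ' (sv Q Qp)).
  have [vQ1 [c Ic nc]] := vQ; split; last by exists c => //; apply: Iq.
  (* Multiplication by u maps P^-1 I into I and leaves valuations at Q unchanged. *)
  have [u [Pu nQu]] : exists u, P u /\ ~ Q u.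
    apply: contrapT => H; case/eqP: PQ; apply: prime_maximal => // x Px.
    by apply: contrapT => nQx; apply: H; exists x.
  move=> z qz; apply: (ideal_exp_cancel Qp gQn gQP gQinv nQu).
  by apply: vQ1; apply: (prime_mul_quot_ideal gP).
- exists t0 => //; rewrite (sz _ tT) big_cons mulnC st; congr (_ * _)%N.
  by rewrite (ideal_norm_coset_reps _ rT) //; apply: prime_sub.
Qed.

End Ideals.

(** * Heights *)

Lemma prod_count_mem (R : comPzRingType) (T : eqType) (N : T -> R) (r s : seq T) :
  uniq r -> {subset s <= r} ->
  \prod_(x <- r) N x ^+ count_mem x s = \prod_(x <- s) N x.
Proof.
move=> ur; elim: s => [|y s IHs] sr.
  by rewrite big_nil big1_seq // => x _; rewrite expr0.
rewrite big_cons -IHs; last by move=> x xs; apply: sr; rewrite inE xs orbT.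
have yr : y \in r by apply: sr; rewrite mem_head.
have -> : N y = \prod_(x <- r) N x ^+ (y == x).
  rewrite (bigD1_seq y) //= eqxx expr1 big1 ?mulr1 // => x.
  by rewrite eq_sym => /negbTE->; rewrite expr0.
by rewrite -big_split /=; apply: eq_bigr => x _; rewrite -exprD.
Qed.

Lemma gauss_norm_eq (R : realType) (L : fieldExtType rat) (abs : L -> R)
    (p : {poly L}) (M : R) i0 :
  0 <= M -> (forall i, (i < size p)%N -> abs p`_i <= M) ->
  (i0 < size p)%N -> abs p`_i0 = M -> gauss_norm abs p = M.
Proof.
move=> M0 le lt E; apply/eqP; rewrite eq_le; apply/andP; split.
  by apply: bigmax_le => // i _; apply: le.
rewrite -E; exact: (@le_bigmax _ _ _ 0 (fun i : 'I_(size p) => abs p`_i) (Ordinal lt)).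
Qed.

Section FinitePlaces.
Variables (R : realType) (L : fieldExtType rat).
Local Notation O := (ringOfIntegers L).
Variables (d : nat) (w : 'I_d -> O).
Hypothesis w_span : forall x : O, exists z : 'rV_d, x = latcomb w z.
Hypothesis w_free : forall z : 'rV_d, latcomb w z = 0 -> z = 0.

Variables (p : {poly L}) (b : O) (c : nat -> O).
Hypothesis p_neq0 : p != 0.
Hypothesis b_neq0 : b != 0.
Hypothesis cE : forall i, int_val (c i) = int_val b * p`_i.

Definition content_ideal : set O :=
  [set x | exists f : nat -> O, x = \sum_(i < size p) f i * c i].

Lemma content_ideal_ideal : idealset content_ideal.
Proof.
split; first split.
- by exists (fun=> 0); rewrite big1 // => i _; rewrite mul0r.
- move=> _ _ [f ->] [h ->]; exists (fun i => f i - h i).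
  by rewrite -sumrB; apply: eq_bigr => i _; rewrite mulrBl.
- move=> a _ [f ->]; exists (fun i => a * f i).
  by rewrite mulr_sumr; apply: eq_bigr => i _; rewrite mulrA.
Qed.

Lemma coef_content_ideal i : content_ideal (c i).
Proof.
have [lti|lei] := ltnP i (size p); last first.
  have -> : c i = 0 by apply: int_val_inj; rewrite cE nth_default ?mulr0 ?int_val0.
  by case: content_ideal_ideal => -[].
exists (fun j => (i == j)%:R); rewrite (bigD1 (Ordinal lti)) //= eqxx mul1r.
rewrite big1 ?addr0 // => j; rewrite -val_eqE /= eq_sym => /negbTE->.
by rewrite mul0r.
Qed.

Lemma content_coef_eq0 i : (c i == 0) = (p`_i == 0).
Proof. by rewrite -int_val_eq0 cE mulf_eq0 int_val_eq0 (negbTE b_neq0). Qed.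

Let lc := (size p).-1.
Lemma content_lead_neq0 : c lc != 0.
Proof. by rewrite content_coef_eq0 -lead_coefE lead_coef_eq0. Qed.

Lemma coef_frac i : p`_i = int_val (c i) / int_val b.
Proof. by rewrite cE mulrC mulKf // int_val_eq0. Qed.

(** The valuation of p_i is that of c_i minus eb, and the least valuation among the c_i is that of
    the content ideal. *)
Lemma prime_gauss_norm (P : set O) eb eI : primeset P ->
  vspec_ideal P (principal b) eb -> vspec_ideal P content_ideal eI ->
  gauss_norm (abs_prime R P) p =
    (ideal_norm P)%:R ^+ eb / (ideal_norm P)%:R ^+ eI.
Proof.
move=> Pp [vb1 [y [x Dx] nx]] [vI1 [z [f Dz] nz]].
have [g [gn gP ginv]] := prime_uniformizer_inverse w_span w_free Pp.
have vb : vspec P b eb.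
  split; first by apply: vb1; exists 1; rewrite mulr1.
  move=> H; apply: nx; rewrite Dx mulrC; exact: ideal_exp_mull gP ginv _ _ _ H.
(* If every c_i lay in P^(eI+1), so would every combination of them. *)
have [i0 [i0p vi0]] : exists i0, (i0 < size p)%N /\ vspec P (c i0) eI.
  apply: contrapT => H; apply: nz; rewrite Dz.
  apply: (big_ind (ideal_exp P eI.+1)).
  - apply/(ideal_expE gP ginv) => i _; rewrite int_val0 mulr0; exact: integral0.
  - exact: ideal_expD gP ginv _.
  - move=> i _; apply: (ideal_exp_mull gP ginv); apply: contrapT => nc.
    apply: H; exists i; split; first exact: ltn_ord.
    by split=> //; apply: vI1; apply: coef_content_ideal.
set N := ideal_norm P.
have N1 : (1 < N)%N.
  have [a Pa a0] : exists2 a, P a & a != 0 by case: Pp.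
  have [_ [_ _ [s sT _]]] := ideal_index w_span w_free (prime_ideal Pp) Pa a0.
  rewrite /N (ideal_norm_coset_reps _ sT); last exact: prime_sub.
  exact: prime_ideal_index_gt1 sT.
have N0 : N%:R != 0 :> R by rewrite pnatr_eq0 -lt0n (ltn_trans _ N1).
have absE i m : vspec P (c i) m -> abs_prime R P p`_i = N%:R ^ (eb%:Z - m%:Z).
  move=> vi; rewrite /abs_prime; case: eqP => [pi0|_].
    have [_ []] := vi; apply/(ideal_expE gP ginv) => j _.
    by rewrite cE pi0 !mulr0; apply: integral0.
  by rewrite coef_frac (ord_vspec w_span w_free Pp gn gP ginv vi vb) opprB.
have -> : N%:R ^+ eb / N%:R ^+ eI = N%:R ^ (eb%:Z - eI%:Z) :> R.
  by rewrite expfzDr // exprnN.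
apply: (@gauss_norm_eq _ _ _ _ _ i0) => //; last exact: absE.
  by rewrite exprz_ge0.
move=> i lti; have [ci0|ci0] := eqVneq (c i) 0.
  have /eqP : c i == 0 by rewrite ci0.
  move/eqP; rewrite content_coef_eq0 /abs_prime => ->; exact: exprz_ge0.
have [m vi] := vspec_ex w_span w_free gn gP ginv ci0; rewrite (absE _ _ vi).
apply: ler_weXz2l; first by rewrite ler1n ltnW.
rewrite lerD2l lerN2 lez_nat leqNgt; apply/negP => lt.
have [_ []] := vi; apply: (ideal_exp_le gP ginv lt).
by apply: vI1; apply: coef_content_ideal.
Qed.

Lemma finite_places_product (s t : seq (set O)) :
  (forall Q, Q \in s -> primeset Q) -> (forall Q, Q \in t -> primeset Q) ->
  (forall Q, primeset Q -> vspec_ideal Q (principal b) (count_mem Q s)) ->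
  (forall Q, primeset Q -> vspec_ideal Q content_ideal (count_mem Q t)) ->
  \big[*%R/1]_(P \in @nonzero_prime_ideals O) gauss_norm (abs_prime R P) p =
  (\prod_(Q <- s) ideal_norm Q)%N%:R / (\prod_(Q <- t) ideal_norm Q)%N%:R.
Proof.
move=> sp tp sv tv; set r := undup (s ++ t).
have rp Q : Q \in r -> primeset Q.
  by rewrite mem_undup mem_cat => /orP[/sp|/tp].
have ur : uniq r by apply: undup_uniq.
(* At a prime outside r both exponents are 0 and the Gauss norm is 1. *)
rewrite (@fsbigE _ _ _ _ _ r _ ur); last 2 first.
- by move=> Q /= /rp; apply: (primesetP Q).2.
- move=> Q /(primesetP Q).1 Qp; rewrite mem_undup mem_cat negb_or => /andP[Qs Qt].
  rewrite (prime_gauss_norm Qp (sv _ Qp) (tv _ Qp)).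
  by rewrite (count_memPn Qs) (count_memPn Qt) !expr0 divr1.
rewrite big_seq_cond (eq_bigl (fun Q => Q \in r)); last first.
  move=> Q; case Qr: (Q \in r) => //=; rewrite mem_set //.
  by apply: (primesetP Q).2; apply: rp.
rewrite -big_seq big_seq (eq_bigr (fun Q => (ideal_norm Q)%:R ^+ count_mem Q s /
    (ideal_norm Q)%:R ^+ count_mem Q t)) -?big_seq; last first.
  by move=> Q /rp Qp; rewrite (prime_gauss_norm Qp (sv _ Qp) (tv _ Qp)).
rewrite big_split /= prodfV !prod_count_mem ?natr_prod //.
- by move=> Q Qt; rewrite mem_undup mem_cat Qt orbT.
- by move=> Q Qs; rewrite mem_undup mem_cat Qs.
Qed.

(** All coordinates of elements of mO are divisible by m, so m^d divides det B. *)
Lemma principal_nat_index (B : 'M[int]_d) (m : nat) : b = m%:R ->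
  \det B != 0 -> (forall x, principal b x <-> exists y : 'rV_d, x = latcomb w (y *m B)) ->
  (m ^ d <= `|\det B|)%N.
Proof.
move=> bm dB PB.
have linj : injective (latcomb w).
  by move=> x y E; apply/eqP; rewrite -subr_eq0; apply/eqP/w_free; rewrite latcombB E subrr.
have H i : exists z : 'rV_d, row i B = m%:Z *: z.
  have [|x Dx] := (PB (latcomb w (row i B))).2; first by exists (delta_mx 0 i); rewrite -rowE.
  have [z Dz] := w_span x; exists z; apply: linj.
  by rewrite Dx Dz latcombZ bm mulr_natl.
have [Z ZE] := choice H.
have BE : B = m%:Z *: \matrix_i Z i.
  by apply/row_matrixP=> i; rewrite ZE linearZ /= rowK.
move: dB; rewrite BE detZ mulf_eq0 negb_or => /andP[_ dZ].
by rewrite abszM abszX absz_nat leq_pmulr // absz_gt0.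
Qed.

(** The left side is the scaling factor, up to sign, between the integer polynomial q and the norm
    of p, so this bounds the scaling by the height. *)
Lemma finite_places_bound (m : nat) : b = m%:R ->
  exists B : 'M[int]_d, [/\ \det B != 0,
    (forall x, content_ideal x <-> exists y : 'rV_d, x = latcomb w (y *m B)) &
    m%:R ^+ d / `|\det B|%N%:R <=
    \big[*%R/1]_(P \in @nonzero_prime_ideals O) gauss_norm (abs_prime R P) p].
Proof.
move=> bm; have PI := ideal_principal b.
have Pb : principal b b by exists 1; rewrite mulr1.
have CI := content_ideal_ideal; have Cc := coef_content_ideal lc; have c0 := content_lead_neq0.
have [B [dB HB [t0 t0T st0]]] := ideal_index w_span w_free CI Cc c0.
have [Bb [dBb HBb [s0 s0T ss0]]] := ideal_index w_span w_free PI Pb b_neq0.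
have [s [sp sv [s1 s1T ss1]]] := ideal_factorization w_span w_free PI Pb b_neq0.
have [t [tp tv [t1 t1T st1]]] := ideal_factorization w_span w_free CI Cc c0.
exists B; split=> //.
rewrite (finite_places_product sp tp sv tv) -ss1 -st1.
rewrite (coset_reps_size PI.1 s1T s0T) (coset_reps_size CI.1 t1T t0T) ss0 st0.
rewrite ler_wpM2r ?invr_ge0 // -natrX ler_nat.
exact: principal_nat_index HBb.
Qed.

End FinitePlaces.

(** * The norm polynomial *)

Section IntegralBasis.
Variable L : fieldExtType rat.
Local Notation O := (ringOfIntegers L).
Local Notation d := (\dim {:L}).

Lemma int_val_mulzr (a : O) (z : int) : int_val (a *~ z) = int_val a * z%:~R.
Proof. by rewrite -mulrzr int_valM int_val_int. Qed.

Lemma int_val_mulz (a : O) (z : int) : int_val (a *~ z) = (z%:~R : rat) *: int_val a.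
Proof.
rewrite int_val_mulzr mulrC -in_alg_int.
by rewrite -[in_alg L _]/(_%:A) mulr_algl.
Qed.

Lemma ring_of_integers_basis : exists (t : L) (A : 'M[rat]_d) (w : 'I_d -> O),
  [/\ <<1; t>>%VS = {:L}%VS, \det A != 0,
      (forall i, int_val (w i) = lincomb t (row i A)),
      (forall x : O, exists z : 'rV_d, x = latcomb w z)
    & (forall z : 'rV_d, latcomb w z = 0 -> z = 0)].
Proof.
have [t t_int t_gen] := integral_primitive_element L.
have [A dA [AI Aspan]] := integral_basis t_gen t_int.
have [w wE] := choice (fun i => isint_lift (AI i)).
exists t, A, w.
have latE z : int_val (latcomb w z) = lincomb t (map_mx intr z *m A).
  rewrite int_val_sum lincomb_mulmx; apply: eq_bigr => i _.
  by rewrite int_val_mulz wE mxE.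
split=> //.
  move=> x; have [z Dz] := Aspan _ (int_val_isint x); exists z.
  by apply: int_val_inj; rewrite latE.
move=> z /(congr1 (@int_val L)); rewrite latE int_val0 => /(lincomb_eq0 t_gen).
move/(congr1 (mulmx^~ (invmx A))); rewrite mulmxK ?mul0mx ?unitmxE ?unitfE //.
move=> E; apply/rowP=> i; move/rowP/(_ i)/eqP: E.
by rewrite !mxE intr_eq0 => /eqP.
Qed.

Variables (K : numFieldType) (s : 'I_d -> {rmorphism L -> K}).
Variables (t : L) (A : 'M[rat]_d) (w : 'I_d -> O).
Hypothesis s_inj : injective (fun i => s i t).
Hypothesis dA : \det A != 0.
Hypothesis wE : forall i, int_val (w i) = lincomb t (row i A).

Lemma det_embedding_basis : \det (\matrix_(i, j) s j (int_val (w i))) != 0.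
Proof.
have -> : \matrix_(i, j) s j (int_val (w i)) =
    map_mx ratr A *m \matrix_(i < d, j < d) s j t ^+ i.
  apply/matrixP=> i j; rewrite !mxE wE morph_lincomb; apply: eq_bigr => l _.
  by rewrite !mxE.
by rewrite det_mulmx mulf_neq0 ?det_embeddings // det_map_mx fmorph_eq0.
Qed.

Variables (p : {poly L}) (m : nat) (c : nat -> O) (B : 'M[int]_d).
Hypothesis cE : forall i, int_val (c i) = int_val (m%:R : O) * p`_i.
Hypothesis cB : forall x, content_ideal p c x <-> exists y : 'rV_d, x = latcomb w (y *m B).

Lemma latcomb_mulmx (y : 'rV_d) :
  latcomb w (y *m B) = \sum_j latcomb w (row j B) *~ y 0 j.
Proof.
rewrite /latcomb.
under [RHS]eq_bigr do rewrite mulrz_suml.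
rewrite exchange_big /=; apply: eq_bigr => i _.
by rewrite mxE mulrz_sumr; apply: eq_bigr => j _; rewrite mxE mulrC mulrzA.
Qed.

(* q is the norm of p divided by the norm of its content ideal: the determinant
   of multiplication by m p, from a Z-basis of the integers to one of the
   content ideal of m p. *)
Lemma norm_polynomial : exists q : {poly int},
  (\det B)%:~R *: map_poly intr q =
  (m%:R ^+ d) *: \prod_i map_poly (s i) p :> {poly K}.
Proof.
have mem_c l i : content_ideal p c (c l * w i).
  apply: ideal_mulr; first exact: content_ideal_ideal.
  exact: coef_content_ideal cE _.
(* Each c_l w_i lies in the content ideal, so its coordinates in a basis of that ideal are integers.
   This is why q stays integral after division by the content. *)
have [y yE] : {y : nat * 'I_d -> 'rV_d & forall li, c li.1 * w li.2 = latcomb w (y li *m B)}.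
  apply: (@choice _ _ (fun li (y : 'rV_d) => c li.1 * w li.2 = latcomb w (y *m B))).
  by move=> -[l i]; apply/cB; apply: mem_c.
pose M : 'M[{poly int}]_d := \matrix_(i, j) \poly_(l < size p) y (l, i) 0 j.
pose V := \matrix_(i, j) s j (int_val (w i)).
pose W := \matrix_(i, j) s j (int_val (latcomb w (row i B))).
pose D : 'rV[{poly K}]_d := \row_j (m%:R *: map_poly (s j) p).
exists (\det M).
have WE : W = map_mx intr B *m V.
  apply/matrixP=> i j; rewrite !mxE int_val_sum rmorph_sum; apply: eq_bigr => l _.
  by rewrite !mxE int_val_mulzr rmorphM /= rmorph_int mulrC.
(* Entry (i, j) is the j-th embedding applied to m p w_i, expanded on the left in the basis of the
   content ideal. In determinants, W = B V lets det V cancel. *)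
have main : map_mx (map_poly intr) M *m map_mx polyC W = map_mx polyC V *m diag_mx D.
  apply/matrixP=> i j; rewrite mul_mx_diag mxE [RHS]mxE [X in _ = X * _]mxE [X in _ = _ * X]mxE.
  rewrite [X in _ = X%:P * _]mxE; apply/polyP=> l.
  rewrite coef_sum coefCM coefZ coef_map /=.
  have termE k : (map_mx (map_poly intr) M i k * map_mx polyC W k j)`_l =
      (if (l < size p)%N then y (l, i) 0 k else 0)%:~R * s j (int_val (latcomb w (row k B))).
    by rewrite !mxE coefMC coef_map coef_poly.
  under eq_bigr do rewrite termE.
  case: ltnP => [lt|le]; last first.
    rewrite nth_default // (rmorph0 (s j)) !mulr0 big1 // => k _; by rewrite mul0r.
  have -> : s j (int_val (w i)) * (m%:R * s j p`_l) = s j (int_val (c l * w i)).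
    rewrite int_valM cE !rmorphM /= -[m%:R : O]/((m%:Z)%:~R) int_val_int.
    by rewrite rmorph_int mulrC.
  rewrite (yE (l, i)) latcomb_mulmx int_val_sum rmorph_sum; apply: eq_bigr => k _.
  by rewrite int_val_mulzr rmorphM /= rmorph_int mulrC.
have V0 : \det V != 0 := det_embedding_basis.
have := congr1 determinant main; rewrite !det_mulmx det_diag !det_map_mx WE det_mulmx.
rewrite det_map_mx rmorphM /= mulrA mulrC => /mulfI.
rewrite polyC_eq0 => /(_ V0) E.
rewrite -[LHS]mul_polyC [LHS]mulrC; apply: etrans E _.
under eq_bigr do rewrite mxE.
by rewrite scaler_prod prodr_const card_ord.
Qed.

End IntegralBasis.

Lemma common_denominator (L : fieldExtType rat) (r : seq L) :
  exists2 m : nat, (0 < m)%N & forall x, x \in r -> isint (m%:R * x).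
Proof.
elim: r => [|y r [m m0 mr]]; first by exists 1%N.
have [c c0 cy] := integral_multiple y.
exists (`|c| * m)%N; first by rewrite muln_gt0 absz_gt0 c0.
move=> x; rewrite inE natrM => /orP[/eqP->|/mr mx]; last first.
  by rewrite -mulrA; apply: isintM => //; apply: integral_nat.
have -> : `|c|%N%:R = c%:~R * (sgz c)%:~R :> L.
  by rewrite -intrM mulrC -abszEsg.
rewrite -!mulrA mulrCA [c%:~R * _]mulrCA.
apply: isintM; first exact: integral_id.
by apply: isintM => //; apply: integral_nat.
Qed.

Lemma normcE (R : rcfType) (x : R[i]) : `|x| = (Normc.normc x)%:C%C.
Proof. by []. Qed.

Section Height.
Variables (R : realType) (L : fieldExtType rat).
Local Notation d := (\dim {:L}).
Local Notation O := (ringOfIntegers L).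

Lemma embeddings_product (t : L) (s : 'I_d -> {rmorphism L -> R[i]}) (F : (L -> R[i]) -> R) :
  injective (fun i => s i t) -> (forall u : {rmorphism L -> R[i]}, exists i, u =1 s i) ->
  \big[*%R/1]_(u \in @embeddings R L) F u = \prod_i F (s i).
Proof.
move=> inj all; pose r : seq (L -> R[i]) := [seq (s i : L -> R[i]) | i <- enum 'I_d].
have ur : uniq r.
  by rewrite map_inj_uniq ?enum_uniq // => i j E; apply: inj; rewrite /= E.
have memr u : embeddings u -> u \in r.
  case=> v ->; have [i vi] := all v; apply/mapP; exists i; rewrite ?mem_enum //.
  exact/funext.
rewrite (@fsbigE _ _ _ _ _ r _ ur); last 2 first.
- by move=> u /= /mapP[i _ ->]; exists (s i).
- by move=> u /memr ->.
rewrite big_mkcond /= big_map big_enum /=; apply: eq_bigr => i _.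
by rewrite mem_set //; exists (s i).
Qed.

Variables (p : {poly L}) (n : nat).
Hypothesis sp : size p = n.+1.

(** This is H(p)^d, before the root is taken. *)
Definition height_pow : R :=
  (\big[*%R/1]_(P \in @nonzero_prime_ideals (ringOfIntegers L))
      gauss_norm (abs_prime R P) p) *
   (\big[*%R/1]_(s \in @embeddings R L) gauss_norm (abs_embedding s) p).

(** Leading coefficient, constant coefficient and [negadet] are multiplicative over the conjugates
    of p, whose coefficients are bounded by the Gauss norms. The last clause transfers the condition
    on roots from p to q: as G is rational, every conjugate of p divides it. *)
Lemma height_norm_polynomial : exists q : {poly int},
  [/\ size q = (n * d).+1,
     forall l, l = 0%N \/ l = (n * d)%N -> (absz q`_l)%:R <= height_pow,
     forall m, `|negadet m q|%N%:R <=
        height_pow ^+ m.+1 * (m.+1`!%:R * n.+1%:R ^+ m.+1) ^+ d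
   & forall G : {poly rat}, p %| map_poly (in_alg L) G -> map_poly intr q %| G ^+ d].
Proof.
have p0 : p != 0 by rewrite -size_poly_eq0 sp.
have [t [A [w [t_gen dA wE w_span w_free]]]] := ring_of_integers_basis L.
have [m m0 mp] := common_denominator p.
have [c cE] : {c : nat -> O & forall i, int_val (c i) = int_val (m%:R : O) * p`_i}.
  apply: (@choice _ _ (fun i a => int_val a = int_val (m%:R : O) * p`_i)) => i.
  apply: isint_lift; rewrite -[m%:R : O]/((m%:Z)%:~R) int_val_int.
  have [lt|le] := ltnP i (size p); first by apply: mp; rewrite mem_nth.
  by rewrite nth_default // mulr0; apply: integral0.
have b0 : (m%:R : O) != 0.
  rewrite -int_val_eq0 -[m%:R : O]/((m%:Z)%:~R) int_val_int -in_alg_int fmorph_eq0.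
  by rewrite intr_eq0 eqz_nat -lt0n.
have [B [dB HB le]] := finite_places_bound R w_span w_free p0 b0 cE (erefl _).
have [s [s_inj s_all]] := embeddings_enum t_gen R[i].
have [q qE] := norm_polynomial s_inj dA wE cE HB.
pose e i := gauss_norm (abs_embedding (s i)) p.
have e0 i : 0 <= e i.
  rewrite /e /gauss_norm; apply: (big_ind (fun x => 0 <= x)) => //.
    by move=> x y x0 y0; rewrite le_max x0.
  move=> j _; rewrite /abs_embedding -lecR -normcE; exact: normr_ge0.
have eP i l : `|(map_poly (s i) p)`_l| <= ((e i)%:C)%C.
  rewrite coef_map /= normcE lecR; have [lt|ge] := ltnP l (size p).
    exact: (@le_bigmax _ _ _ 0 (fun j : 'I_(size p) => abs_embedding (s i) p`_j) (Ordinal lt)).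
  by rewrite nth_default // rmorph0 Normc.normc0.
have HE : height_pow = (\big[*%R/1]_(P \in @nonzero_prime_ideals O)
      gauss_norm (abs_prime R P) p) * \prod_i e i.
  by rewrite /height_pow (embeddings_product _ s_inj s_all).
set D := `|\det B|%N in le.
have D0 : (0 < D)%N by rewrite absz_gt0.
have D0R : (0 < D%:R :> R) by rewrite ltr0n.
have E0 : 0 <= \prod_i e i by apply: prodr_ge0.
have leH : m%:R ^+ d / D%:R * \prod_i e i <= height_pow by rewrite HE ler_wpM2r.
have H0 : 0 <= m%:R ^+ d / D%:R * \prod_i e i.
  by rewrite mulr_ge0 // divr_ge0 // exprn_ge0.
set Pi := \prod_i map_poly (s i) p in qE.
have PiE : map_poly intr q = (m%:R ^+ d / (\det B)%:~R) *: Pi.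
  by rewrite mulrC -scalerA -qE scalerA mulVf ?scale1r // intr_eq0.
have mD0 : m%:R ^+ d / (\det B)%:~R != 0 :> R[i].
  by rewrite mulf_neq0 ?invr_eq0 ?intr_eq0 // expf_neq0 // pnatr_eq0 -lt0n.
have normint (z : int) : `|z%:~R : R[i]| = (`|z|%N%:R)%:C%C.
  by rewrite -intr_norm -abszE rmorph_nat.
have normmD : `|m%:R ^+ d / (\det B)%:~R : R[i]| = (m%:R ^+ d / D%:R)%:C%C.
  by rewrite normf_div normrX normr_nat normint -/D [RHS]fmorph_div rmorphXn !rmorph_nat.
have sPi i : size (map_poly (s i) p) = n.+1 by rewrite size_map_poly.
have sq : size q = (n * d).+1.
  have <- : size (map_poly (intr : int -> R[i]) q) = size q.
    by apply: size_map_inj_poly => //; apply: intr_inj.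
  rewrite PiE size_scale // size_prod; last by move=> i _; rewrite -size_poly_eq0 sPi.
  rewrite (eq_bigr (fun=> n.+1)) // sum_nat_const card_ord.
  by rewrite mulnS subSn ?leq_addr // addKn mulnC.
have finish (a : int) : `|a%:~R : R[i]| <= `|m%:R ^+ d / (\det B)%:~R| * \prod_i ((e i)%:C)%C ->
    `|a|%N%:R <= height_pow.
  rewrite normint normmD -rmorph_prod -rmorphM lecR => H; exact: le_trans leH.
exists q; split=> //.
- move=> l lE; apply: finish.
  have -> : (q`_l)%:~R = m%:R ^+ d / (\det B)%:~R *
      \prod_i (map_poly (s i) p)`_(if l == 0%N then 0%N else n) :> R[i].
    have -> : (q`_l)%:~R = (map_poly (intr : int -> R[i]) q)`_l by rewrite coef_map.
    rewrite PiE coefZ; congr (_ * _); case: eqVneq lE => [-> _|l0 lE].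
      by rewrite /Pi -[LHS]horner_coef0 horner_prod; apply: eq_bigr => i _; rewrite horner_coef0.
    have {}lE : l = (n * d)%N by case: lE => // E; rewrite E eqxx in l0.
    have -> : l = (size Pi).-1.
      by rewrite -(size_scale Pi mD0) -PiE size_map_inj_poly ?sq //; apply: intr_inj.
    rewrite -lead_coefE lead_coef_prod; apply: eq_bigr => i _.
    by rewrite lead_coefE sPi.
  rewrite normrM normr_prod ler_wpM2l //.
  by apply: ler_prod => i _; rewrite normr_ge0 eP.
- move=> k.
  (* The scaling factor enters to the power k + 1, the size of the matrix; this matches the exponent
     of the Gauss norms and yields that of the height. *)
  have neg : (negadet k q)%:~R = (m%:R ^+ d / (\det B)%:~R) ^+ k.+1 *
      \prod_i negadet k (map_poly (s i) p) :> R[i].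
    have <- := negadet_map (intr : {rmorphism int -> R[i]}) k q.
    by rewrite /= PiE -mul_polyC negadetM negadetC negadet_prod.
  apply: (@le_trans _ _ ((m%:R ^+ d / D%:R * \prod_i e i) ^+ k.+1 *
      (k.+1`!%:R * n.+1%:R ^+ k.+1) ^+ d)); last first.
    rewrite ler_wpM2r ?exprn_ge0 ?mulr_ge0 ?exprn_ge0 //.
    by apply: lerXn2r => //; rewrite nnegrE (le_trans H0).
  rewrite -lecR -normint neg normrM normr_prod normrX normmD.
  have -> : (((m%:R ^+ d / D%:R * \prod_i e i) ^+ k.+1 * (k.+1`!%:R * n.+1%:R ^+ k.+1) ^+ d)%:C)%C =
    ((m%:R ^+ d / D%:R)%:C)%C ^+ k.+1 * \prod_i (k.+1`!%:R * (n.+1%:R * ((e i)%:C)%C) ^+ k.+1).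
    have -> : (m%:R ^+ d / D%:R * \prod_i e i) ^+ k.+1 * (k.+1`!%:R * n.+1%:R ^+ k.+1) ^+ d =
        (m%:R ^+ d / D%:R) ^+ k.+1 * \prod_i (k.+1`!%:R * (n.+1%:R * e i) ^+ k.+1).
      rewrite exprMn -mulrA -prodrXl; congr (_ * _).
      rewrite -[X in _ * _ ^+ X]card_ord -prodr_const -big_split /=.
      by apply: eq_bigr => i _; rewrite exprMn mulrC mulrA.
    rewrite rmorphM rmorphXn rmorph_prod; congr (_ * _); apply: eq_bigr => i _.
    by rewrite rmorphM rmorphXn rmorphM !rmorph_nat.
  apply: ler_wpM2l; first by rewrite exprn_ge0 // -normmD.
  apply: ler_prod => i _; rewrite normr_ge0 /=.
  apply: negadet_bound => //; by rewrite sPi.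
- move=> G pG.
  rewrite -(dvdp_map (ratr : {rmorphism rat -> R[i]})) -map_poly_comp.
  rewrite (eq_map_poly (g := intr)); last by move=> z; rewrite /= rmorph_int.
  rewrite PiE dvdpZl // rmorphXn /= -[X in _ ^+ X]card_ord -prodr_const.
  rewrite /Pi; elim/big_ind2: _ => [|x1 x2 y1 y2 ? ?|i _]; rewrite ?dvdpp //; first exact: dvdp_mul.
  have -> : map_poly ratr G = map_poly (s i) (map_poly (in_alg L) G).
    by rewrite -map_poly_comp; apply: eq_map_poly => a; rewrite -(rat_algE (s i)).
  by rewrite dvdp_map.
Qed.
End Height.

(** * Conjugate roots and the final estimate *)

Lemma minCpoly_root_neq0 (z : algC) : z != 0 -> ~~ root (minCpoly z) 0.
Proof.
move=> z0; have [pr [Dpr mpr] dv] := minCpolyP z; rewrite Dpr; apply/negP => r0.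
have /factor_theorem[h Dh] : root pr 0.
  by rewrite -(fmorph_root (ratr : {rmorphism rat -> algC})) rmorph0.
rewrite subr0 in Dh.
have pr0 : pr != 0 by apply: monic_neq0.
have h0 : h != 0 by apply: contraNneq pr0 => E; rewrite Dh E mul0r.
have := root_minCpoly z; rewrite Dpr Dh rmorphM rootM /= map_polyX rootX (negbTE z0) orbF.
rewrite dv => /(dvdp_leq h0); by rewrite Dh size_mulX // ltnn.
Qed.

Lemma minCpoly_conjugate (y z : algC) : root (minCpoly y) z ->
  (size (minCpoly z) <= size (minCpoly y))%N.
Proof.
have [pz [-> mz] dv] := minCpolyP z; have [py [-> my] _] := minCpolyP y.
by rewrite dv !size_map_poly => /dvdp_leq; apply; apply: monic_neq0.
Qed.

(** Take the product of the minimal polynomials of the roots. The roots of the norm polynomial are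
    conjugates of roots of f, in general not roots of f; such a G covers them all. *)
Lemma rational_multiple (k : nat) (f : {poly algC}) : f != 0 ->
  (forall z, root f z -> z != 0 /\ ((size (minCpoly z)).-1 <= k)%N) ->
  exists2 G : {poly rat}, f %| map_poly ratr G &
    forall z : algC, root (map_poly ratr G) z -> z != 0 /\ ((size (minCpoly z)).-1 <= k)%N.
Proof.
move=> f0 fz; have [r Dr] := closed_field_poly_normal f.
suff [G dvG Gz] : exists2 G : {poly rat}, \prod_(z <- r) ('X - z%:P) %| map_poly ratr G &
    forall z : algC, root (map_poly ratr G) z -> z != 0 /\ ((size (minCpoly z)).-1 <= k)%N.
  by exists G; rewrite // Dr dvdpZl ?lead_coef_eq0.
have {fz Dr} rz z : z \in r -> z != 0 /\ ((size (minCpoly z)).-1 <= k)%N.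
  by move=> zr; apply: fz; rewrite Dr rootZ ?lead_coef_eq0 // root_prod_XsubC.
elim: r rz => [|y r IHr] rz.
  exists 1; first by rewrite big_nil rmorph1.
  by move=> z; rewrite rmorph1 (negbTE (root1 _)).
have [z zr|G dvG Gz] := IHr; first by apply: rz; rewrite inE zr orbT.
have [y0 ky] := rz y (mem_head _ _).
have [py [Dpy _] _] := minCpolyP y.
exists (py * G).
  rewrite big_cons rmorphM /= dvdp_mul // dvdp_XsubCl -Dpy; exact: root_minCpoly.
move=> z; rewrite rmorphM rootM /= -Dpy => /orP[yz|/Gz//]; split.
  by apply: contraTneq yz => ->; apply: minCpoly_root_neq0.
by apply: leq_trans ky; rewrite -!subn1 leq_sub2r // minCpoly_conjugate.
Qed.

Lemma ln_natS_littleo (R : realType) (a b : R) : 0 <= a -> 0 <= b ->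
  (fun n : nat => a + b * ln n.+1%:R) =o_\oo (fun n => n%:R : R).
Proof.
move=> a0 b0; apply/eqoP => eps eps0.
(* In ln y <= ln M + y / M this makes the slope b / M at most eps / 2; the other eps / 2 absorbs the
   constants for large n. *)
pose M := 2 * b / eps + 1.
have M0 : 0 < M by rewrite ltr_wpDl // divr_ge0 ?mulr_ge0 // ltW.
have lnb (n : nat) : ln n.+1%:R <= ln M + n.+1%:R / M :> R.
  have y0 : 0 < n.+1%:R / M by rewrite divr_gt0 // ltr0n.
  have E : n.+1%:R = M * (n.+1%:R / M) by rewrite mulrC divfK // gt_eqF.
  rewrite {1}E lnM ?posrE // lerD2l -[X in ln X](subrK 1) addrC.
  by rewrite (le_trans (le_ln1Dx _)) ?gerBl // ltrBrDl subrr.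
have bM : b / M <= eps / 2.
  rewrite ler_pdivrMr // /M mulrDr mulr1.
  have -> : eps / 2 * (2 * b / eps) = b by field; rewrite gt_eqF.
  by rewrite lerDl divr_ge0 // ltW.
pose c := a + b * ln M + b / M.
near=> n.
have nbig : 2 * c / eps <= n%:R by near: n; apply: nbhs_infty_ger.
have ln0n : 0 <= ln n.+1%:R :> R by rewrite ln_ge0 // ler1n.
rewrite ger0_norm ?addr_ge0 ?mulr_ge0 // normr_nat.
have cn : c <= eps / 2 * n%:R.
  by rewrite -ler_pdivrMl ?divr_gt0 // invf_div mulrAC -mulrA mulrC in nbig *; lra.
have := ler_wpM2l b0 (lnb n).
have -> : b * (ln M + n.+1%:R / M) = b * ln M + b / M + b / M * n%:R.
  by rewrite -natr1; field; rewrite gt_eqF.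
have : b / M * n%:R <= eps / 2 * n%:R by rewrite ler_wpM2r.
rewrite /c in cn; lra.
Unshelve. all: by end_near. Qed.

Lemma pow2_leq_absz (r : nat) (z : int) : z != 0 -> (2 ^+ r %| z)%Z -> (2 ^ r <= `|z|)%N.
Proof.
move=> z0 dv; apply: dvdn_leq; first by rewrite absz_gt0.
by move: dv; rewrite /dvdz /= abszX.
Qed.

Theorem theorem1p4 (R : realType) (k : nat) (k_gt0 : (0 < k)%N) :
  exists (C : R) (g : nat -> R),
    g =o_\oo (fun n => n%:R : R) /\
    forall (n : nat) (f : {poly algC}),
      size f = n.+1 ->
      (forall z : algC, root f z -> z != 0 /\ ((size (minCpoly z)).-1 <= k)%N) ->
      forall (L : fieldExtType rat) (iota : {rmorphism L -> algC})
             (p : {poly L}),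
        map_poly iota p = f ->
        n%:R - g n <= C * ln (height R p).
Proof.
pose T := (2 ^ k)`!; pose m := T.-1.
have mT : m.+1 = (2 ^ k)`! by rewrite prednK // fact_gt0.
have ln2 : 0 < ln 2 :> R by rewrite ln_gt0 // ltr1n.
(* With X = H^d, the two coefficients contribute ln X each and the resultant T ln X + d (ln T! + T
   ln (n+1)), where T = m + 1. Multiplying by k and dividing by d ln 2 gives C, a and b, none of
   which depends on L. *)
pose C : R := k%:R * (m.+1 + 2)%:R / ln 2.
pose a : R := k%:R * ln m.+1`!%:R / ln 2; pose b : R := k%:R * m.+1%:R / ln 2.
have a0 : 0 <= a by rewrite divr_ge0 ?mulr_ge0 ?ln_ge0 ?ler1n ?fact_gt0 // ltW.
have b0 : 0 <= b by rewrite divr_ge0 ?mulr_ge0 // ltW.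
exists C, (fun n => a + b * ln n.+1%:R); split; first exact: ln_natS_littleo.
move=> n f sf fz L iota p Dp.
have sp : size p = n.+1 by rewrite -sf -Dp size_map_poly.
have [q [sq qb qD qG]] := height_norm_polynomial R sp.
set X := height_pow R p in qb qD.
have f0 : f != 0 by rewrite -size_poly_eq0 sf.
have [G fG Gz] := rational_multiple f0 fz.
have pG : p %| map_poly (in_alg L) G.
  rewrite -(dvdp_map iota) Dp -map_poly_comp.
  by rewrite (eq_map_poly (g := ratr)) // => x; apply: rat_algE.
have rq z : root (map_poly intr q) z -> z != 0 /\ ((size (minCpoly z)).-1 <= k)%N.
  move=> rz; apply: Gz; have /dvdpP[h Dh] := qG G pG.
  have : root (map_poly ratr (G ^+ \dim {:L})) z.
    rewrite Dh rmorphM rootM /= -map_poly_comp.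
    rewrite (eq_map_poly (g := intr)); first by rewrite rz orbT.
    by move=> x; rewrite /= rmorph_int.
  rewrite rmorphXn /= /root horner_exp expf_eq0.
  by case/andP.
have q0 : q != 0 by rewrite -size_poly_eq0 sq.
have [r1 [r2 [r3 [sr d1 d2 d3]]]] := int_poly_small_degree_roots mT q0 rq.
have qD0 : negadet m q != 0.
  apply: negadet_neq0 => z /rq[_ kz]; apply/eqP => E.
  have := @size_minCpoly_pow_eqN1 k m.+1 z _ isT E.
  rewrite mT dvdn_fact ?expn_gt0 ?leqnn // => /(_ isT).
  by rewrite ltnNge kz.
have q00 : q`_0 != 0.
  apply/eqP => q00; have /rq[] : root (map_poly (intr : int -> algC) q) 0.
    by rewrite rootE horner_coef0 coef_map q00.
  by rewrite eqxx.
have lq0 : lead_coef q != 0 by rewrite lead_coef_eq0.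
set d := \dim {:L} in sq qb qD.
have H1 : 2 ^+ r1 <= X.
  apply: le_trans (qb (n * d)%N (or_intror erefl)); rewrite -natrX ler_nat.
  have <- : lead_coef q = q`_(n * d) by rewrite lead_coefE sq.
  exact: pow2_leq_absz.
have H2 : 2 ^+ r2 <= X.
  apply: le_trans (qb 0%N (or_introl erefl)); rewrite -natrX ler_nat.
  exact: pow2_leq_absz.
have H3 : 2 ^+ r3 <= X ^+ m.+1 * (m.+1`!%:R * n.+1%:R ^+ m.+1) ^+ d.
  apply: le_trans (qD m); rewrite -natrX ler_nat; exact: pow2_leq_absz.
have X0 : 0 < X by apply: lt_le_trans H1; rewrite exprn_gt0.
have p2 r : 0 < 2 ^+ r :> R by rewrite exprn_gt0.
have fp : 0 < m.+1`!%:R :> R by rewrite ltr0n fact_gt0.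
have np : 0 < n.+1%:R :> R by rewrite ltr0n.
have lnp : 0 < n.+1%:R ^+ m.+1 :> R by rewrite exprn_gt0.
have L1 : r1%:R * ln 2 <= ln X by rewrite mulr_natl -lnXn // ler_ln ?posrE.
have L2 : r2%:R * ln 2 <= ln X by rewrite mulr_natl -lnXn // ler_ln ?posrE.
have L3 : r3%:R * ln 2 <= m.+1%:R * ln X + d%:R * (ln m.+1`!%:R + m.+1%:R * ln n.+1%:R).
  have Y0 : 0 < m.+1`!%:R * n.+1%:R ^+ m.+1 :> R by rewrite mulr_gt0.
  rewrite !mulr_natl -!lnXn // -lnM ?posrE // -lnXn // -lnM ?posrE ?exprn_gt0 //.
  by rewrite ler_ln ?posrE // mulr_gt0 // exprn_gt0.
have d0 : (0 < d)%N by rewrite adim_gt0.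
have d0R : 0 < d%:R :> R by rewrite ltr0n.
have lnH : ln (height R p) = d%:R^-1 * ln X by rewrite /height ln_powR.
have nd : n%:R * d%:R <= k%:R * (r1%:R + r2%:R + r3%:R) :> R.
  by rewrite -!natrD -!natrM ler_nat; move: sr; rewrite sq.
have main : n%:R * d%:R * ln 2 <= k%:R * ((m.+1 + 2)%:R * ln X +
    d%:R * (ln m.+1`!%:R + m.+1%:R * ln n.+1%:R)).
  apply: (@le_trans _ _ (k%:R * (r1%:R + r2%:R + r3%:R) * ln 2)).
    by rewrite ler_wpM2r // ltW.
  rewrite -mulrA ler_wpM2l // natrD.
  by move: L1 L2 L3; clear; lra.
rewrite lnH /C /a /b lerBlDr.
have -> : k%:R * (m.+1 + 2)%:R / ln 2 * (d%:R^-1 * ln X) +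
   (k%:R * ln m.+1`!%:R / ln 2 + k%:R * m.+1%:R / ln 2 * ln n.+1%:R) =
   k%:R * ((m.+1 + 2)%:R * ln X + d%:R * (ln m.+1`!%:R + m.+1%:R * ln n.+1%:R)) /
   (d%:R * ln 2) :> R.
  by field; rewrite !gt_eqF.
by rewrite ler_pdivlMr ?mulr_gt0 // mulrA.
Qed.
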